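(* Fix $L\in(1,2]$ and let $\widehat\tau$ be a minimizer over $\tau\in\{2,\dots,n\}$ of $\mathrm{Cr}_1(Y,\tau)=\|Y-\Pi_\tau Y\|^2+L\,\mathrm{pen}_1(\tau)$. There exist positive constants $c$ (numerical), $c_L$ and $c'_L$ (depending only on $L$) such that the following holds for all $n\geq c'_L$ and all $\theta\in\Theta_1$. If $$E_1^2(\theta)>L^2\,\mathrm{pen}_1(\tau^* )+c_L,$$ then, for any $x\in\left(0,\ (E_1^2(\theta)-L^2\mathrm{pen}_1(\tau^* )-c_L)/c_L\right)$, with probability larger than $1-32e^{-x}$, $$|\widehat{\tau}-\tau^*|\leq c\,\frac{\max(1,x)}{\Delta^2}\quad\text{and}\quad \frac{(\widehat{\tau}-1)(n+1-\tau^* )}{(\tau^*-1)(n+1-\widehat{\tau})}\in (1/2,2).$$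
   Context: Model: $Y_i=\theta_i+\epsilon_i$, $i=1,\dots,n$, where $\epsilon_1,\dots,\epsilon_n$ are independent, mean-zero and satisfy $\mathbb{E}[e^{t\epsilon_i}]\leq e^{t^2/2}$ for all $t\in\mathbb{R}$. $\Theta_1\subset\mathbb{R}^n$ is the set of vectors with exactly one change-point: there are $\tau^*\in\{2,\dots,n\}$ and reals $\mu_1\ne\mu_2$ with $\theta_i=\mu_1$ for $i<\tau^*$ and $\theta_i=\mu_2$ for $i\ge\tau^*$; $\Delta=\mu_2-\mu_1$, and $E_1(\theta)=|\Delta|\sqrt{(\tau^*-1)(n+1-\tau^* )/n}$. For $\tau\in\{2,\dots,n\}$, $\Pi_\tau$ is the orthogonal projection of $\mathbb{R}^n$ onto the vectors constant on $\{1,\dots,\tau-1\}$ and constant on $\{\tau,\dots,n\}$, $\|\cdot\|$ is the Euclidean norm, and with $x\wedge y=\min(x,y)$, $$\mathrm{pen}_1(\tau)= 2\log\log\left(e\max\left\{\tau\wedge \frac{n}{\tau},\ (n+1-\tau)\wedge\frac{n}{n+1-\tau}\right\}\right).$$ *)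

(* Defs.v *)
From HB Require Import structures.
From mathcomp Require Import all_boot all_order all_algebra.
From mathcomp Require Import all_classical all_reals all_analysis.
Set Implicit Arguments.
Unset Strict Implicit.
Unset Printing Implicit Defensive.
Import Order.TTheory GRing.Theory Num.Theory.
Import numFieldNormedType.Exports.
Local Open Scope classical_set_scope.
Local Open Scope ring_scope.

(* A vector (u_1, ..., u_n) of R^n is u : 'rV[R]_n; the
   coordinate u_k is u 0 i with k = i.+1, since i : 'I_n ranges over
   0, ..., n.-1. Change-points are kept as elements of {2, ..., n}. *)

Definition independent_rvs d (T : measurableType d) (R : realType)
    (P : probability T R) (I : finType) (X : I -> {RV P >-> R}) : Prop :=
  forall (J : {set I}) (B : I -> set R), (forall i, measurable (B i)) ->
    P (\bigcap_(i in [set` J]) (X i @^-1` B i)) =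
    (\prod_(i in J) P (X i @^-1` B i))%E.
Arguments independent_rvs {d T R} P {I} X.

(* The library norm on 'rV[R]_n is the sup norm, hence these two. *)
Definition dotp (R : realType) n (u v : 'rV[R]_n) : R :=
  \sum_(i < n) u 0 i * v 0 i.

Definition enorm (R : realType) n (u : 'rV[R]_n) : R := Num.sqrt (dotp u u).

Definition is_orthoproj (R : realType) n (W : set 'rV[R]_n)
    (u p : 'rV[R]_n) : Prop :=
  W p /\ forall w, W w -> dotp (u - p) w = 0.

(* For the subspaces used below, the projection exists and is unique: see
   [PiP] and [Pi_unique]. *)
Definition orthoproj (R : realType) n (W : set 'rV[R]_n) (u : 'rV[R]_n) :
  'rV[R]_n := xget 0 [set p | is_orthoproj W u p].

Definition change_point (n tau : nat) : bool := (2 <= tau <= n)%N.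

Definition two_pieces (R : realType) n (tau : nat) : set 'rV[R]_n :=
  [set u | (forall i j : 'I_n, (i.+1 < tau)%N -> (j.+1 < tau)%N ->
              u 0 i = u 0 j)
        /\ (forall i j : 'I_n, (tau <= i.+1)%N -> (tau <= j.+1)%N ->
              u 0 i = u 0 j)].

Definition Pi (R : realType) n (tau : nat) (u : 'rV[R]_n) : 'rV[R]_n :=
  orthoproj (two_pieces tau) u.

Definition pen1 (R : realType) (n tau : nat) : R :=
  2 * ln (ln (expR 1 *
    Num.max (Num.min tau%:R (n%:R / tau%:R))
            (Num.min (n.+1%:R - tau%:R) (n%:R / (n.+1%:R - tau%:R))))).

Definition Cr1 (R : realType) (L : R) n (y : 'rV[R]_n) (tau : nat) : R :=
  enorm (y - Pi tau y) ^+ 2 + L * pen1 R n tau.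

Definition minimizes_Cr1 (R : realType) (L : R) n (y : 'rV[R]_n)
    (tauh : nat) : Prop :=
  change_point n tauh /\
  forall tau, change_point n tau -> Cr1 L y tauh <= Cr1 L y tau.

(* theta belongs to Theta_1, with change-point tau and levels mu1, mu2 (all
   three being determined by theta). *)
Definition in_Theta1 (R : realType) n (theta : 'rV[R]_n) (tau : nat)
    (mu1 mu2 : R) : Prop :=
  [/\ change_point n tau, mu1 != mu2
    & forall i : 'I_n, theta 0 i = if (i.+1 < tau)%N then mu1 else mu2].

Definition energy1 (R : realType) (n tau : nat) (Delta : R) : R :=
  `|Delta| * Num.sqrt ((tau%:R - 1) * (n.+1%:R - tau%:R) / n%:R).

Definition observation (R : realType) (T : Type) n (theta : 'rV[R]_n)
    (eps : 'I_n -> T -> R) (w : T) : 'rV[R]_n :=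
  \row_i (theta 0 i + eps i w).

Lemma Pi_exists (R : realType) n (tau : nat) (u : 'rV[R]_n) :
  exists p, is_orthoproj (@two_pieces R n tau) u p.
Proof.
pose b (i : 'I_n) := (i.+1 < tau)%N.
pose m (c : bool) : R :=
  (\sum_(j < n | b j == c) u 0 j) / #|[pred j | b j == c]|%:R.
exists (\row_i m (b i)); split.
  split=> i j hi hj; rewrite !mxE /b; first by rewrite hi hj.
  by rewrite !ltnNge hi hj.
move=> w [w1 w2].
have key (c : bool) : \sum_(i < n | b i == c) (u 0 i - m (b i)) * w 0 i = 0.
  have [k /eqP bk|no] := pickP [pred i | b i == c]; last first.
    by rewrite big_pred0.
  rewrite (eq_bigr (fun i => (u 0 i - m c) * w 0 k)); last first.
    move=> i /eqP bi; rewrite bi; congr (_ * _).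
    move: bi bk; rewrite /b; case: c => bi bk; first exact: w1.
    by apply: w2; rewrite leqNgt ?bi ?bk.
  rewrite -mulr_suml sumrB sumr_const -[m c *+ _]mulr_natr.
  rewrite /m divfK ?subrr ?mul0r//.
  by rewrite pnatr_eq0 -lt0n; apply/card_gt0P; exists k; rewrite inE bk.
rewrite /dotp (bigID (fun i => b i == true)) /=.
rewrite [X in X + _](_ : _ = 0) ?add0r; last first.
  by rewrite -[RHS](key true); apply: eq_bigr => i _; rewrite !mxE.
rewrite -[RHS](key false); apply: eq_big => [i|i _]; last by rewrite !mxE.
by case: (b i).
Qed.

Lemma PiP (R : realType) n (tau : nat) (u : 'rV[R]_n) :
  is_orthoproj (two_pieces tau) u (Pi tau u).
Proof. exact: (@xgetPex _ _ [set p | _] (Pi_exists tau u)). Qed.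

Lemma Pi_unique (R : realType) n (tau : nat) (u p : 'rV[R]_n) :
  is_orthoproj (two_pieces tau) u p -> p = Pi tau u.
Proof.
move=> [[p1 p2] po]; have [[q1 q2] qo] := PiP tau u.
set q := Pi tau u in q1 q2 qo *.
have W : two_pieces tau (p - q).
  split=> i j hi hj; rewrite !mxE; first by rewrite (p1 i j)// (q1 i j).
  by rewrite (p2 i j)// (q2 i j).
have d0 : \sum_(i < n) (p - q) 0 i ^+ 2 = 0.
  transitivity (dotp (u - q) (p - q) - dotp (u - p) (p - q)); last first.
    by rewrite po ?qo ?subrr.
  rewrite /dotp -sumrB; apply: eq_bigr => i _; rewrite !mxE expr2 -mulrBl.
  by congr (_ * _); rewrite opprB [RHS]addrC addrA subrK.
apply/eqP; rewrite -subr_eq0; apply/eqP/rowP => i; rewrite [RHS]mxE.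
apply/eqP; rewrite -sqrf_eq0; apply/eqP.
by apply: (psumr_eq0P _ d0) => // j _; exact: sqr_ge0.
Qed.

(* Main.v *)
Require Import Defs.
From HB Require Import structures.
From mathcomp Require Import all_boot all_order all_algebra.
From mathcomp Require Import all_classical all_reals all_analysis.
From mathcomp Require Import measurable_realfun ring lra.
Import Order.TTheory GRing.Theory Num.Theory.
Import numFieldNormedType.Exports.
Set Implicit Arguments.
Unset Strict Implicit.
Unset Printing Implicit Defensive.
Local Open Scope classical_set_scope.
Local Open Scope ring_scope.

(* Put a = tau - 1, b = tau* - 1 and let S be the partial sums of the noise.
   Minimizing Cr1 amounts to maximizing (rho E_1 + N_a)^2 - L pen_1, where N_a
   is a normalized noise term (up to a common sign) and
   rho^2 = a (n - b) / (b (n - a)) for a <= b; reversing time exchanges a < b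
   and a > b.  Every probabilistic bound comes from one inequality: the
   exponential supermartingale of the partial sums keeps S below a line for all
   times simultaneously, except with probability exp (- y).
   - rho^2 small: lines at two geometric grids of scales (starting from 1 and
     from n), with levels x + (1 + u) log (j + 1), give the law of the iterated
     logarithm with a constant close enough to 1 to be paid by L pen_1(tau).
   - rho^2 between a constant and 1/2: lines at the scales b and n - b give
     N_a^2 = O(x), and the loss of energy (1 - rho^2) E_1^2 dominates.
   - rho^2 close to 1: the lines issued from b, of slope |Delta| / 32, show
     that the loss of energy dominates as soon as
     |a - b| > 512 x / Delta^2, with no dependence on L. *)

(** * Expectation of a product of independent variables *)

(** The joint law agrees with the product of the laws on rectangles, hence equals it, and Tonelli
    separates the integrals. General target spaces allow [U] to be the identity onto a coarser
    sigma-algebra. *)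
Lemma integral_prod_indep d d1 d2 (T : measurableType d)
    (T1 : measurableType d1) (T2 : measurableType d2) (R : realType)
    (P : probability T R) (U : {mfun T >-> T1}) (V : {mfun T >-> T2})
    (f : T1 -> \bar R) (g : T2 -> \bar R) :
  (forall A B, measurable A -> measurable B ->
    P (U @^-1` A `&` V @^-1` B) = P (U @^-1` A) * P (V @^-1` B))%E ->
  measurable_fun setT f -> measurable_fun setT g ->
  (forall u, 0 <= f u)%E -> (forall v, 0 <= g v)%E ->
  (\int[P]_w (f (U w) * g (V w)) = \int[P]_w f (U w) * \int[P]_w g (V w))%E.
Proof.
move=> UV mf mg f0 g0.
have mUV : measurable_fun setT (fun w => (U w, V w)).
  by apply/measurable_fun_pairP; split; exact: measurable_funPT.
pose UV' : {mfun T >-> (T1 * T2)%type} := mfun_Sub (mem_set mUV).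
pose F (z : T1 * T2) := (f z.1 * g z.2)%E.
have mF : measurable_fun setT F.
  apply: emeasurable_funM; apply: measurableT_comp => //.
have F0 z : (0 <= F z)%E by exact: mule_ge0.
transitivity (\int[distribution P UV']_z F z)%E.
  by rewrite ge0_integral_distribution.
transitivity (\int[distribution P U \x distribution P V]_z F z)%E.
  apply/esym/eq_measure_integral => A mA _.
  apply: product_measure_unique => // B C mB mC; exact: UV.
rewrite fubini_tonelli1// /fubini_F /F/=.
under eq_integral do rewrite ge0_integralZl//.
rewrite ge0_integralZr//; last exact: integral_ge0.
by rewrite !ge0_integral_distribution.
Qed.

(** * Line crossing for sums of independent sub-Gaussian variables *)

(** Independence in the form used by an induction on time: only initial segments occur, and
    variables of index [m] or more are left free. *)
Definition product_rule d (T : measurableType d) (R : realType)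
    (P : probability T R) (m : nat) (Y : nat -> {RV P >-> R}) : Prop :=
  forall k, (k <= m)%N -> forall B : nat -> set R,
    (forall i, measurable (B i)) ->
    P (\bigcap_(i < k) Y i @^-1` B i) = (\prod_(i < k) P (Y i @^-1` B i))%E.

Section past.
Context d (T : measurableType d) (R : realType) (P : probability T R).
Variables (m : nat) (Y : nat -> {RV P >-> R}).
Hypothesis Yprod : product_rule m Y.

(** A pi-system generating the past at time [k], the sigma-algebra of the first [k] variables. *)
Definition cylinders k : set (set T) :=
  [set A | exists B : nat -> set R,
     (forall i, measurable (B i)) /\ A = \bigcap_(i < k) Y i @^-1` B i].

Lemma cylinders_measurable k : cylinders k `<=` measurable.
Proof.
move=> _ [B [mB ->]]; apply: bigcap_measurableType => i _.
exact: measurable_funPTI.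
Qed.

Lemma cylinders_setI k : setI_closed (cylinders k).
Proof.
move=> _ _ [B [mB ->]] [C [mC ->]]; exists (fun i => B i `&` C i); split.
  by move=> i; exact: measurableI.
by rewrite -bigcapI.
Qed.

Lemma past_measurable k (A : set T) : <<s cylinders k >> A -> measurable A.
Proof.
by apply: smallest_sub; [exact: sigma_algebra_measurable
                        |exact: cylinders_measurable].
Qed.

(** Both sides are finite measures in [A] that agree on the pi-system of cylinders, hence on the
    sigma-algebra it generates. *)
Lemma past_indep k A (C : set R) : (k < m)%N -> <<s cylinders k >> A ->
  measurable C -> (P (A `&` Y k @^-1` C) = P A * P (Y k @^-1` C))%E.
Proof.
move=> km sA mC.
have mYC : measurable (Y k @^-1` C) by exact: measurable_funPTI.
pose p := fine (P (Y k @^-1` C)).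
have p0 : 0 <= p by exact: fine_ge0.
have pE : p%:E = P (Y k @^-1` C) by rewrite fineK// fin_num_measure.
suff : mrestr P mYC A = mscale (NngNum p0) P A.
  by move=> H; rewrite -[LHS]/(mrestr P mYC A) H muleC -pE.
apply: (g_sigma_algebra_measure_unique (cylinders k) (@cylinders_measurable k)
  (fun=> setT)) => //.
- move=> _; exists (fun=> setT); split=> //.
  by rewrite bigcapT.
- by rewrite bigcup_const//; exists 0%N.
- exact: cylinders_setI.
- move=> _ [B [mB ->]]; rewrite -[RHS]/(p%:E * P _)%E pE /mrestr.
  (* Intersecting a cylinder of length [k] with the event on [Y k] gives a cylinder of length
     [k + 1], to which the product rule applies. *)
  pose B' i := if i == k then C else B i.
  have mB' i : measurable (B' i) by rewrite /B'; case: ifP.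
  have B'k : B' k = C by rewrite /B' eqxx.
  have B'lt i : (i < k)%N -> B' i = B i by move=> ik; rewrite /B' (ltn_eqF ik).
  have := Yprod km mB'; rewrite big_ord_recr/= B'k.
  under eq_bigr do rewrite B'lt//.
  rewrite -(Yprod (ltnW km) mB) [RHS]muleC => <-; congr (P _).
  apply/seteqP; split=> [w [wB wC] i /=|w wB].
    rewrite ltnS leq_eqVlt => /predU1P[->|ik]; first by rewrite B'k.
    by rewrite B'lt//; exact: wB.
  split=> [i /= ik|]; last by have /= := wB k (ltnSn k); rewrite B'k.
  by have /= := wB i (ltnW ik); rewrite B'lt.
- by move=> _; rewrite -[X in (X < _)%E]/(P (setT `&` Y k @^-1` C)) setTI
     ltey_eq fin_num_measure.
Qed.

Lemma measurable_past k i : (i < k)%N ->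
  measurable_fun (setT : set (g_sigma_algebraType (cylinders k))) (Y i).
Proof.
move=> ik _ B mB; rewrite setTI; apply: sub_sigma_algebra.
exists (fun j => if j == i then B else setT); split.
  by move=> j; case: ifP.
apply/seteqP; split=> [w wB j /= _|w /(_ i ik)]; last by rewrite eqxx.
by have [->|//] := eqVneq j i.
Qed.

(** The identity, seen as a map onto the past sigma-algebra, is a variable independent of [Y k];
    [integral_prod_indep] applies to it. *)
Lemma integral_past k (f g : _ -> R) : (k < m)%N ->
  measurable_fun (setT : set (g_sigma_algebraType (cylinders k))) f ->
  measurable_fun setT g -> (forall w, 0 <= f w) -> (forall y, 0 <= g y) ->
  (\int[P]_w (f w * g (Y k w))%:E =
   \int[P]_w (f w)%:E * \int[P]_w (g (Y k w))%:E)%E.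
Proof.
move=> km mf mg f0 g0.
have mid : measurable_fun setT (id : T -> g_sigma_algebraType (cylinders k)).
  by move=> _ A sA; rewrite setTI; exact: past_measurable sA.
pose U : {mfun T >-> g_sigma_algebraType (cylinders k)} :=
  mfun_Sub (mem_set mid).
rewrite -(@integral_prod_indep _ _ _ _ _ _ _ P U (Y k) (EFin \o f) (EFin \o g)).
- by [].
- by move=> A B sA mB; exact: past_indep.
- exact: measurableT_comp.
- exact: measurableT_comp.
- by move=> u; rewrite lee_fin.
- by move=> u; rewrite lee_fin.
Qed.

End past.

(* Q holds off an event of probability at most p; Q need not be measurable. *)
Definition outside_bad d (T : measurableType d) (R : realType)
    (P : probability T R) (p : R) (Q : T -> Prop) : Prop :=
  exists A, [/\ measurable A, (P A <= p%:E)%E & forall w, ~ A w -> Q w].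

Section outside_bad_theory.
Context d (T : measurableType d) (R : realType) (P : probability T R).

Lemma outside_badI p q (Q1 Q2 : T -> Prop) : outside_bad P p Q1 ->
  outside_bad P q Q2 -> outside_bad P (p + q) (fun w => Q1 w /\ Q2 w).
Proof.
move=> [A [mA PA AQ]] [B [mB PB BQ]]; exists (A `|` B); split.
- exact: measurableU.
- by rewrite EFinD (le_trans (measureU2 _ _ _))// leeD.
- by move=> w /not_orP[nA nB]; split; [exact: AQ|exact: BQ].
Qed.

Lemma outside_bad_forall N (p : nat -> R) (Q : nat -> T -> Prop) :
  (forall j, outside_bad P (p j) (Q j)) ->
  outside_bad P (\sum_(j < N) p j) (fun w => forall j, (j < N)%N -> Q j w).
Proof.
move=> PQ; elim: N => [|N [A [mA PA AQ]]].
  by exists set0; split=> //; rewrite measure0 big_ord0.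
have [B [mB PB BQ]] := PQ N; exists (A `|` B); split.
- exact: measurableU.
- by rewrite big_ord_recr EFinD (le_trans (measureU2 _ _ _))// leeD.
- move=> w /not_orP[nA nB] j; rewrite ltnS leq_eqVlt => /predU1P[->|jN].
    exact: BQ.
  exact: AQ.
Qed.

Lemma outside_bad_sub p q (Q1 Q2 : T -> Prop) : p <= q ->
  (forall w, Q1 w -> Q2 w) -> outside_bad P p Q1 -> outside_bad P q Q2.
Proof.
move=> pq Q12 [A [mA PA AQ]]; exists A; split=> //.
- by rewrite (le_trans PA)// lee_fin.
- by move=> w /AQ/Q12.
Qed.

End outside_bad_theory.

Section maximal_inequality.
Context d (T : measurableType d) (R : realType) (P : probability T R).

Definition subgaussian (Y : {RV P >-> R}) :=
  forall t : R, ('M_P Y t <= (expR (t ^+ 2 / 2))%:E)%E.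

Variables (m : nat) (Y : nat -> {RV P >-> R}).
Hypothesis Yprod : product_rule m Y.
Hypothesis Ysub : forall k, (k < m)%N -> subgaussian (Y k).
Variable l : R.

Let incr k w := expR (l * Y k w - l ^+ 2 / 2).

(* The exponential supermartingale, frozen once it has reached level C. *)
Fixpoint frozen (C : R) k w : R :=
  if k isn't k'.+1 then 1 else
  if C <= frozen C k' w then frozen C k' w else frozen C k' w * incr k' w.

Lemma frozen_ge0 C k w : 0 <= frozen C k w.
Proof.
by elim: k => //= k IH; case: ifP => // _; rewrite mulr_ge0// expR_ge0.
Qed.

(** The induction runs on the time [j <= k] while the sigma-algebra stays that of time [k], so pasts
    at different times need not be compared. *)
Lemma measurable_frozen C k :
  measurable_fun (setT : set (g_sigma_algebraType (cylinders Y k)))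
    (frozen C k).
Proof.
suff H j : (j <= k)%N ->
  measurable_fun (setT : set (g_sigma_algebraType (cylinders Y k)))
    (frozen C j).
  exact: H.
elim: j => [_|j IH jk]; first exact: measurable_cst.
apply: measurable_fun_ifT => /=.
- by apply: measurable_fun_ler; [exact: measurable_cst|exact: IH (ltnW jk)].
- exact: IH (ltnW jk).
- apply: measurable_funM; first exact: IH (ltnW jk).
  apply: measurableT_comp => //; apply: measurable_funB => //.
  by apply: measurable_funM => //; exact: measurable_past.
Qed.

Lemma integral_incr k : (k < m)%N -> (\int[P]_w (incr k w)%:E <= 1)%E.
Proof.
move=> km; have := Ysub km l; rewrite /mmt_gen_fun unlock => H.
under eq_integral do rewrite /incr expRD mulrC EFinM.
rewrite ge0_integralZl//=.
- rewrite expRN lee_pdivrMl ?expR_gt0// mule1.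
  by under eq_integral do rewrite mulrC.
- apply: measurableT_comp => //; apply: measurableT_comp => //.
  exact: measurable_funM.
Qed.

Lemma integral_frozen C k : (k <= m)%N -> (\int[P]_w (frozen C k w)%:E <= 1)%E.
Proof.
elim: k => [_|k IH km].
  by rewrite [leLHS](@integral_cst _ _ _ P setT measurableT 1%E) mul1e
    probability_le1.
rewrite (le_trans _ (IH (ltnW km)))//.
have mW := @measurable_frozen C k.
(* Here [f] is the part still moving and [g] the part already frozen. Only [f] gets multiplied by
   the next increment, which is independent of the past and has mean at most 1. *)
pose f w := if C <= frozen C k w then 0 else frozen C k w.
pose g w := if C <= frozen C k w then frozen C k w else 0.
have f0 w : 0 <= f w by rewrite /f; case: ifP => // _; exact: frozen_ge0.
have g0 w : 0 <= g w by rewrite /g; case: ifP => // _; exact: frozen_ge0.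
have mf : measurable_fun (setT : set (g_sigma_algebraType (cylinders Y k))) f.
  by apply: measurable_fun_ifT => //; apply: measurable_fun_ler.
have mg : measurable_fun (setT : set (g_sigma_algebraType (cylinders Y k))) g.
  by apply: measurable_fun_ifT => //; apply: measurable_fun_ler.
have past (h : T -> R) :
    measurable_fun (setT : set (g_sigma_algebraType (cylinders Y k))) h ->
    measurable_fun (setT : set T) h.
  by move=> mh _ B mB; have := mh measurableT B mB; exact: past_measurable.
have mi : measurable_fun setT (incr k).
  apply: measurableT_comp => //; apply: measurable_funB => //.
  exact: measurable_funM.
have mi' : measurable_fun setT (fun y : R => expR (l * y - l ^+ 2 / 2)).
  apply: measurableT_comp => //; apply: measurable_funB => //.
have -> : (\int[P]_w (frozen C k.+1 w)%:E =
    \int[P]_w (g w)%:E + \int[P]_w (f w * incr k w)%:E)%E.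
  rewrite -ge0_integralD//=.
  - apply: eq_integral => w _; rewrite -EFinD; congr EFin.
    by rewrite /f /g; case: ifP; rewrite ?mul0r ?addr0 ?add0r.
  - by move=> w _; rewrite lee_fin.
  - by apply: measurableT_comp => //; exact: past.
  - by move=> w _; rewrite lee_fin mulr_ge0// expR_ge0.
  - by apply: measurableT_comp => //; apply: measurable_funM => //; exact: past.
have -> : (\int[P]_w (frozen C k w)%:E =
    \int[P]_w (g w)%:E + \int[P]_w (f w)%:E)%E.
  rewrite -ge0_integralD//=.
  - apply: eq_integral => w _; rewrite -EFinD; congr EFin.
    by rewrite /f /g; case: ifP; rewrite ?addr0 ?add0r.
  - by move=> w _; rewrite lee_fin.
  - by apply: measurableT_comp => //; exact: past.
  - by move=> w _; rewrite lee_fin.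
  - by apply: measurableT_comp => //; exact: past.
rewrite leeD2l// (integral_past Yprod km mf mi' f0 (fun=> expR_ge0 _)).
rewrite -[leRHS]mule1; apply: lee_wpmul2l.
  by apply: integral_ge0 => w _; rewrite lee_fin.
exact: (integral_incr km).
Qed.

Lemma frozen_stays C j k w : (j <= k)%N -> C <= frozen C j w ->
  C <= frozen C k w.
Proof. by move=> /subnK <- Cj; elim: (k - j)%N => //= i Ci; rewrite Ci. Qed.

Lemma frozenE C k w : C <= frozen C k w \/
  frozen C k w = expR (l * (\sum_(i < k) Y i w) - l ^+ 2 * k%:R / 2).
Proof.
elim: k => [|k [Ck|E]] /=.
- by right; rewrite big_ord0 !(mulr0, mul0r) subrr expR0.
- by left; rewrite Ck.
- case: ifPn => [Ck|_]; [by left|right].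
  rewrite E -[incr k w]/(expR (_ - _)) -expRD big_ord_recr/= -natr1.
  by congr expR; ring.
Qed.

(** Freezing turns a maximum over time into a terminal value: a path that ever reaches level
    [expR y] is still above it at time [m], so Markov's inequality at time [m] suffices. *)
Lemma line_crossing y : outside_bad P (expR (- y)) (fun w =>
  forall k, (k <= m)%N ->
    l * (\sum_(i < k) Y i w) - l ^+ 2 * k%:R / 2 < y).
Proof.
have mW : measurable_fun (setT : set T) (frozen (expR y) m).
  by move=> _ B mB; have := @measurable_frozen (expR y) m measurableT B mB;
     exact: past_measurable.
exists [set w | (expR y <= frozen (expR y) m w)%R]; split.
- rewrite -[X in measurable X]setTI; exact: measurable_fun_le.
- have := integral_frozen (expR y) (leqnn m).
  pose W : {RV P >-> R} := mfun_Sub (mem_set mW).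
  have := @markov _ _ _ P W id _ (expR_gt0 y) (@measurable_id _ _ _)
    (fun _ => id) (fun _ _ _ _ => id).
  have -> : [set w | ((expR y)%:E <= `|(W w)%:E|)%E] =
      [set w | expR y <= frozen (expR y) m w].
    by apply/seteqP; split=> w /=; rewrite lee_fin ger0_norm ?frozen_ge0.
  rewrite unlock => H1 H2.
  have -> : (expR (- y))%:E = ((expR y)^-1%:E * 1)%E by rewrite mule1 expRN.
  rewrite lee_pdivlMl ?expR_gt0//; apply: (le_trans H1); apply: le_trans H2.
  apply: ge0_le_integral => //.
  - by move=> w _ /=; rewrite lee_fin.
  - by apply: measurableT_comp => //; apply: measurableT_comp.
  - exact: measurableT_comp.
  - by move=> w _ /=; rewrite lee_fin ger0_norm ?frozen_ge0.
- move=> w /= nC k km; rewrite -ltr_expR.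
  have [/(frozen_stays km)//|<-] := frozenE (expR y) k w.
  by rewrite ltNge; apply/negP => /(frozen_stays km).
Qed.

End maximal_inequality.

(** * Noise partial sums below lines, forward and backward in time *)

(** Injectivity is asked only below [m] because the enumerations used later are total functions that
    repeat values beyond their horizon. *)
Lemma product_rule_reindex d (T : measurableType d) (R : realType)
    (P : probability T R) n (eps : 'I_n -> {RV P >-> R}) m (f : nat -> 'I_n) :
  independent_rvs P eps -> {in gtn m &, injective f} ->
  product_rule m (eps \o f).
Proof.
move=> ind finj k km B mB.
have injk : injective (fun i : 'I_k => f i).
  move=> i j /finj /= E; apply: val_inj; apply: E;
    by rewrite inE (leq_trans (ltn_ord _) km).
(* [B'] carries [B] along [f], with no constraint off the image. *)
pose B' j := if [pick i : 'I_k | f i == j] is Some i then B i else setT.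
have B'f (i : 'I_k) : B' (f i) = B i.
  rewrite /B'; case: pickP => [j /eqP/injk->//|/(_ i)]; by rewrite eqxx.
have mB' j : measurable (B' j) by rewrite /B'; case: pickP.
have := ind [set f (nat_of_ord i) | i in 'I_k]%SET B' mB'.
rewrite big_imset/=; last by move=> i j _ _; exact: injk.
under eq_bigr do rewrite B'f.
move=> <-; congr (P _); apply/seteqP; split=> w wB i /=.
  by move=> /imsetP[j _ ->]; rewrite B'f; exact: (wB _ (ltn_ord j)).
move=> ik; have := wB (f (Ordinal ik)) => /=; rewrite (B'f (Ordinal ik)); apply.
by apply/imsetP; exists (Ordinal ik).
Qed.

Definition psum (R : realType) n (u : 'I_n -> R) (a : nat) : R :=
  \sum_(i < n | (i < a)%N) u i.

Lemma psum0 (R : realType) n (u : 'I_n -> R) : psum u 0 = 0.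
Proof. by rewrite /psum big_pred0. Qed.

Lemma psumS (R : realType) n (u : 'I_n -> R) (i : 'I_n) :
  psum u i.+1 = psum u i + u i.
Proof.
rewrite /psum (bigD1 i)//= addrC; congr (_ + _).
by apply: eq_bigl => j; rewrite ltnS [in RHS]ltn_neqAle andbC.
Qed.

Section noise_lines.
Context d (T : measurableType d) (R : realType) (P : probability T R).
Variables (n : nat) (eps : 'I_n -> {RV P >-> R}).
Hypothesis ind : independent_rvs P eps.
Hypothesis sub : forall i, subgaussian (eps i).

(** The exponents [l] and [- l] bound the two signs, whence the factor 2; dividing by [l] gives the
    line. *)
Lemma line_crossing_reindex m (f : nat -> 'I_n) (l y : R) : 0 < l ->
  {in gtn m &, injective f} ->
  outside_bad P (2 * expR (- y)) (fun w => forall k, (k <= m)%N ->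
    `|\sum_(i < k) eps (f i) w| <= l * k%:R / 2 + y / l).
Proof.
move=> l0 finj; have rule := product_rule_reindex ind finj.
have H s := @line_crossing _ _ _ _ _ _ rule (fun k _ => sub (f k)) s y.
rewrite [_ * _](_ : _ = expR (- y) + expR (- y)); last by ring.
apply: (outside_bad_sub (lexx _) _ (outside_badI (H l) (H (- l)))).
move=> w [H1 H2] k km; have := H1 k km; have := H2 k km => /=.
set s := \sum_(i < k) _ => {}H1 {}H2; rewrite -(ler_pM2l l0).
have -> : l * (l * k%:R / 2 + y / l) = l ^+ 2 * k%:R / 2 + y.
  by field; rewrite gt_eqF.
rewrite -{1}(gtr0_norm l0) -normrM ler_norml.
by apply/andP; split; lra.
Qed.

Lemma psum_forward_line b (l y : R) : 0 < l -> (b < n)%N ->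
  outside_bad P (2 * expR (- y)) (fun w => forall k, (b + k <= n)%N ->
    `|psum (eps ^~ w) (b + k) - psum (eps ^~ w) b| <= l * k%:R / 2 + y / l).
Proof.
(* Past the end of the sample [f] takes the default value [b]; only [i < n - b] is ever used. *)
move=> l0 bn; pose f i : 'I_n := insubd (Ordinal bn) (b + i)%N.
have fE i : (b + i < n)%N -> f i = (b + i)%N :> nat.
  by move=> bi; rewrite val_insubd bi.
have finj : {in gtn (n - b)%N &, injective f}.
  move=> i j; rewrite !inE !ltn_subRL => bi bj /(congr1 val) /=.
  by rewrite -![val _]/(nat_of_ord _) !fE// => /addnI.
apply: (outside_bad_sub (lexx _) _ (line_crossing_reindex y l0 finj)).
move=> w H k kb; have -> : psum (eps ^~ w) (b + k) - psum (eps ^~ w) b =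
    \sum_(i < k) eps (f i) w.
  elim: k kb => [|k IH] kb; first by rewrite addn0 subrr big_ord0.
  rewrite addnS in kb; rewrite big_ord_recr/= -(IH (ltnW kb)).
  by rewrite addnS -(fE _ kb) psumS; ring.
by apply: H; rewrite leq_subRL// ltnW.
Qed.

Lemma psum_backward_line b (l y : R) : 0 < l -> (0 < b <= n)%N ->
  outside_bad P (2 * expR (- y)) (fun w => forall k, (k <= b)%N ->
    `|psum (eps ^~ w) b - psum (eps ^~ w) (b - k)| <= l * k%:R / 2 + y / l).
Proof.
move=> l0 /andP[b0 bn].
have b1n : (b.-1 < n)%N by rewrite prednK.
(* The walk goes down from coordinate [b - 1]; for [i < b] the subtraction is not truncated and [f]
   is injective. *)
pose f i : 'I_n := insubd (Ordinal b1n) (b - i.+1)%N.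
have fE i : (i < b)%N -> f i = (b - i.+1)%N :> nat.
  by move=> bi; rewrite val_insubd (leq_trans _ bn)// -subSn// subSS leq_subr.
have finj : {in gtn b &, injective f}.
  move=> i j; rewrite !inE => bi bj /(congr1 val) /=.
  rewrite -![val _]/(nat_of_ord _) !fE// => /eqP.
  by rewrite eqn_sub2lE// => /eqP[].
apply: (outside_bad_sub (lexx _) _ (line_crossing_reindex y l0 finj)).
move=> w H k kb; have -> : psum (eps ^~ w) b - psum (eps ^~ w) (b - k) =
    \sum_(i < k) eps (f i) w.
  elim: k kb => [|k IH] kb; first by rewrite subn0 subrr big_ord0.
  rewrite big_ord_recr/= -(IH (ltnW kb)).
  by rewrite -(subnSK kb) -(fE _ kb) psumS; ring.
exact: H.
Qed.

End noise_lines.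

(** * The criterion as a CUSUM contrast *)

Lemma psum_full (R : realType) n (u : 'I_n -> R) : psum u n = \sum_(i < n) u i.
Proof. by apply: eq_bigl => i; rewrite ltn_ord. Qed.

Lemma psumD (R : realType) n (u v : 'I_n -> R) a :
  psum (fun i => u i + v i) a = psum u a + psum v a.
Proof. exact: big_split. Qed.

Lemma sum_two_levels (R : realType) n (u : 'I_n -> R) a (c1 c2 : R) :
  \sum_(i < n) u i * (if (i < a)%N then c1 else c2) =
  psum u a * c1 + (psum u n - psum u a) * c2.
Proof.
rewrite psum_full (bigID (fun i : 'I_n => (i < a)%N))/=; congr (_ + _).
  by rewrite /psum mulr_suml; apply: eq_bigr => i ->.
rewrite (bigID (fun i : 'I_n => (i < a)%N) _ u)/= -/(psum u a) addrAC subrr.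
rewrite add0r mulr_suml; by apply: eq_bigr => i /negbTE ->.
Qed.

(** Truncated subtraction lets one formula cover both orders of [a] and [b]. *)
Lemma psum_two_levels (R : realType) n a b (c1 c2 : R) : (a <= n)%N ->
  psum (fun i : 'I_n => if (i < b)%N then c1 else c2) a =
  c1 * (minn a b)%:R + c2 * (a - b)%:R.
Proof.
move=> an.
have E : psum (fun i : 'I_n => if (i < b)%N then c1 else c2) a =
    \sum_(i < a) (if (i < b)%N then c1 else c2).
  by rewrite /psum (big_ord_widen _ (fun i => if (i < b)%N then c1 else c2) an).
rewrite E -(big_mkord xpredT (fun i => if (i < b)%N then c1 else c2)).
have [ab|ba] := leqP a b.
  rewrite (eq_big_nat _ _ (F2 := fun=> c1)); last first.
    by move=> i /andP[_ ia]; rewrite (leq_trans ia ab).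
  by rewrite sumr_const_nat subn0 (eqP ab) mulr0 addr0 mulr_natr.
rewrite (@big_cat_nat _ _ _ b)//=; last exact: ltnW.
rewrite (eq_big_nat _ _ (F2 := fun=> c1)); last by move=> i /andP[_ ->].
rewrite [X in _ + X](eq_big_nat _ _ (F2 := fun=> c2)); last first.
  by move=> i /andP[bi _]; rewrite ltnNge bi.
by rewrite !sumr_const_nat subn0 !mulr_natr.
Qed.

(** The squared CUSUM statistic for a first piece of length [a]: the drop in residual sum of squares
    when one constant is replaced by two. *)
Definition cusum2 (R : realType) n (u : 'I_n -> R) (a : nat) : R :=
  (psum u a - a%:R / n%:R * psum u n) ^+ 2 * (n%:R / (a%:R * (n%:R - a%:R))).

Lemma change_point_pred (R : realType) n tau : change_point n tau ->
  [/\ tau = tau.-1.+1, (0 < tau.-1 < n)%N, 0 < tau.-1%:R :> R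
    & tau.-1%:R < n%:R :> R].
Proof.
case: tau => [|[|a]]// /andP[_ an]; split=> //=; by rewrite ltr_nat.
Qed.

(** Subtracting the mean on each piece leaves a residual orthogonal to vectors constant on the
    pieces; uniqueness of the projection concludes. *)
Lemma Pi_two_levels (R : realType) n tau (y : 'rV[R]_n) : change_point n tau ->
  let T := psum (y 0) in let a := tau.-1 in
  Pi tau y = \row_i (if (i < a)%N then T a / a%:R
                     else (T n - T a) / (n%:R - a%:R)).
Proof.
move=> /[dup] /(change_point_pred R)[tE /andP[a0 an] ra0 ran] _ T a.
rewrite -/a in tE a0 an ra0 ran.
apply/esym/Pi_unique; split.
  split=> i j; rewrite tE !ltnS => ia ja; rewrite !mxE.
    by rewrite ia ja.
  by rewrite ltnNge ia ltnNge ja.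
move=> w; rewrite tE => -[w1 w2].
pose i1 := Ordinal (ltn_trans a0 an); pose i2 := Ordinal an.
have wE i : w 0 i = if (i < a)%N then w 0 i1 else w 0 i2.
  case: ifP => ia; first exact: w1.
  by apply: w2 => //=; rewrite ltnS leqNgt ia.
rewrite /dotp; under eq_bigr do rewrite wE.
rewrite sum_two_levels.
have E : psum ((y - \row_i (if (i < a)%N then T a / a%:R
                     else (T n - T a) / (n%:R - a%:R))) 0) =1
   fun k => T k - psum (fun i : 'I_n => if (i < a)%N then T a / a%:R
                     else (T n - T a) / (n%:R - a%:R)) k.
  move=> k; rewrite /T /psum -sumrB; apply: eq_bigr => i _; by rewrite !mxE.
rewrite !E !psum_two_levels//; last exact: ltnW.
rewrite minnn subnn (minn_idPr (ltnW an)) natrB ?(ltnW an)//.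
field; by rewrite subr_eq0 !gt_eqF.
Qed.

(** By orthogonality the residual is [dotp y y - dotp y (Pi tau y)]. The first two terms of the
    result do not involve [tau], so minimizing the criterion maximizes [cusum2] minus the
    penalty. *)
Lemma Cr1_cusum2 (R : realType) (L : R) n tau (y : 'rV[R]_n) :
  change_point n tau ->
  Cr1 L y tau = dotp y y - psum (y 0) n ^+ 2 / n%:R
    - cusum2 (y 0) tau.-1 + L * pen1 R n tau.
Proof.
move=> /[dup] cp /(change_point_pred R)[tE /andP[a0 an] ra0 ran].
rewrite /Cr1; congr (_ + _).
have dot0 (u : 'rV[R]_n) : 0 <= dotp u u.
  by apply: sumr_ge0 => i _; rewrite -expr2 sqr_ge0.
rewrite sqr_sqrtr//.
have [W orth] := PiP tau y.
have -> : dotp (y - Pi tau y) (y - Pi tau y) =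
    dotp y y - dotp y (Pi tau y) - dotp (y - Pi tau y) (Pi tau y).
  by rewrite /dotp -!sumrB; apply: eq_bigr => i _; rewrite !mxE; ring.
rewrite orth// subr0 -addrA -opprD; congr (_ - _).
rewrite Pi_two_levels// /dotp.
under eq_bigr do rewrite mxE.
rewrite sum_two_levels /cusum2; field.
by rewrite subr_eq0 !gt_eqF// (lt_trans ra0).
Qed.

(** * Comparison of two contrasts *)

(* E2, Ba ^+ 2 * wa and r stand for E_1^2, N_a^2 and rho^2, and
   D * X = E_1 (N_b - rho N_a): the squares are expanded so that no square root
   occurs. *)
Section contrast.
Variable R : realFieldType.
Implicit Types a b n S D L p u x y : R.

(** With [h = n - a] the bridge is [(h * S - a * S') / n]; the difference of the two sides is a sum
    of nonnegative terms, one being the square that absorbs the cross term. A small [u] keeps the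
    factor of [S] close to 1. *)
Lemma bridge_sqr_le u a n S S' : 0 < u -> 0 < a < n ->
  (S - a / n * (S + S')) ^+ 2 * (n / (a * (n - a))) <=
  (1 + u) * (S ^+ 2 / a) + (1 + u^-1) * (S' ^+ 2 / (n - a)).
Proof.
move=> u0 /andP[a0 an]; pose h := n - a; have h0 : 0 < h by rewrite subr_gt0.
have -> : n = a + h by rewrite /h; ring.
have ah0 : 0 < a + h by rewrite addr_gt0.
have -> : a + h - a = h by ring.
rewrite -subr_ge0.
have -> : (1 + u) * (S ^+ 2 / a) + (1 + u^-1) * (S' ^+ 2 / h) -
    (S - a / (a + h) * (S + S')) ^+ 2 * ((a + h) / (a * h)) =
    (u * ((h * S + a * S' / u) ^+ 2) + (1 + u) * a * h * S ^+ 2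
      + (1 + u^-1) * a * h * S' ^+ 2) / ((a + h) * a * h).
  by field; rewrite !gt_eqF.
apply: divr_ge0; last by rewrite !mulr_ge0 ?ltW.
have ui : 0 < u^-1 by rewrite invr_gt0.
do 2?apply: addr_ge0; apply: mulr_ge0 (sqr_ge0 _); rewrite ?ltW//.
  by rewrite !mulr_gt0// addr_gt0.
by rewrite !mulr_gt0// addr_gt0.
Qed.

Variables (a b n D L pa pb Sa Sb Sn : R).
Hypotheses (a0 : 0 < a) (ab : a < b) (bn : b < n) (D0 : 0 < D).

Let E2 := D ^+ 2 * (b * (n - b) / n).
Let r := a * (n - b) / (b * (n - a)).
Let Ba := Sa - a / n * Sn.
Let Bb := Sb - b / n * Sn.
Let wa := n / (a * (n - a)).
Let wb := n / (b * (n - b)).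
Let X := (Sb - Sa) - (b - a) / (n - a) * (Sn - Sa).

Let b0 : 0 < b := lt_trans a0 ab.
Let n0 : 0 < n := lt_trans b0 bn.
Let nb0 : 0 < n - b. Proof. by rewrite subr_gt0. Qed.
Let na0 : 0 < n - a. Proof. by rewrite subr_gt0 (lt_trans ab). Qed.
Let nz : [/\ a != 0, b != 0, n != 0, n - a != 0 & n - b != 0].
Proof. by split; rewrite gt_eqF. Qed.

Let E2_gt0 : 0 < E2. Proof. by rewrite !(mulr_gt0, invr_gt0). Qed.
Let wa_gt0 : 0 < wa. Proof. by rewrite !(mulr_gt0, invr_gt0). Qed.
Let wb_gt0 : 0 < wb. Proof. by rewrite !(mulr_gt0, invr_gt0). Qed.
Let r_gt0 : 0 < r. Proof. by rewrite !(mulr_gt0, invr_gt0). Qed.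
Let r_lt1 : r < 1.
Proof.
rewrite ltr_pdivrMr ?mulr_gt0// mul1r -subr_gt0.
have -> : b * (n - a) - a * (n - b) = n * (b - a) by ring.
by rewrite mulr_gt0// subr_gt0.
Qed.

Let contrast_aE : (Ba + a * (n - b) / n * D) ^+ 2 * wa =
  Ba ^+ 2 * wa + 2 * D * (Ba * ((n - b) / (n - a))) + r * E2.
Proof.
case: nz => *; rewrite /wa /r /E2; move: Ba => B.
by field; do ?[apply/andP; split].
Qed.

Let contrast_bE : (Bb + b * (n - b) / n * D) ^+ 2 * wb =
  Bb ^+ 2 * wb + 2 * D * Bb + E2.
Proof.
case: nz => *; rewrite /wb /E2; move: Bb => B.
by field; do ?[apply/andP; split].
Qed.

Let XE : X = Bb - Ba * ((n - b) / (n - a)).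
Proof.
case: nz => *; rewrite /X /Bb /Ba.
by field; do ?[apply/andP; split].
Qed.

(** The difference of squares factors through the increment [X], up to a remainder carrying [1 - r];
    both shrink as [a] approaches [b]. *)
Let sqr_diffE : Bb ^+ 2 * wb - Ba ^+ 2 * wa =
  X * ((Bb + Ba * ((n - b) / (n - a))) * wb) - (1 - r) * (Ba ^+ 2 * wa).
Proof.
case: nz => *; rewrite XE /wb /wa /r; move: Ba Bb => A B.
by field; do ?[apply/andP; split].
Qed.

(** This rests on [E2 * wb = D ^+ 2]: noise against energy becomes bridge against jump. *)
Let small_b k : 0 <= k -> Bb ^+ 2 * wb <= k ^+ 2 * E2 -> `|Bb| * wb <= k * D.
Proof.
move=> k0 H; rewrite -(@ler_pXn2r _ 2) ?nnegrE
  ?(mulr_ge0 (normr_ge0 _) (ltW wb_gt0)) ?(mulr_ge0 k0 (ltW D0))//.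
rewrite (exprMn 2 `|_| wb) (exprMn 2 k) real_normK ?num_real//.
have -> : k ^+ 2 * D ^+ 2 = k ^+ 2 * E2 * wb.
  by case: nz => *; rewrite /E2 /wb; field; do ?[apply/andP; split].
by rewrite [wb ^+ 2]expr2 mulrA ler_pM2r.
Qed.

Let small_a k : 0 <= k -> Ba ^+ 2 * wa <= k ^+ 2 * E2 ->
  `|Ba * ((n - b) / (n - a))| * wb <= k * D.
Proof.
move=> k0 H; rewrite -(@ler_pXn2r _ 2) ?nnegrE
  ?(mulr_ge0 (normr_ge0 _) (ltW wb_gt0)) ?(mulr_ge0 k0 (ltW D0))//.
rewrite (exprMn 2 `|_| wb) (exprMn 2 k) real_normK ?num_real//.
have -> : (Ba * ((n - b) / (n - a))) ^+ 2 * wb ^+ 2 = r * wb * (Ba ^+ 2 * wa).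
  case: nz => *; rewrite /r /wb /wa; move: Ba => A.
  by field; do ?[apply/andP; split].
have -> : k ^+ 2 * D ^+ 2 = wb * (k ^+ 2 * E2).
  by case: nz => *; rewrite /E2 /wb; field; do ?[apply/andP; split].
apply: ler_pM => //.
- exact: mulr_ge0 (ltW r_gt0) (ltW wb_gt0).
- exact: mulr_ge0 (sqr_ge0 _) (ltW wa_gt0).
- exact: ler_piMl (ltW wb_gt0) (ltW r_lt1).
Qed.

(** All perturbations are measured against the loss [(1 - r) * E2]: squared noise and penalty take
    1/64 each, and [X * (2 * D + Z)] at most 9/4 * 3/8 = 27/32, because [Z] is at most [D / 4] in
    absolute value. *)
Lemma contrast_lt_close :
  Ba ^+ 2 * wa <= E2 / 64 -> Bb ^+ 2 * wb <= E2 / 64 ->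
  `|L * (pb - pa)| <= (1 - r) * E2 / 64 ->
  `|X| * D <= 3 / 8 * ((1 - r) * E2) ->
  (Ba + a * (n - b) / n * D) ^+ 2 * wa - L * pa <
  (Bb + b * (n - b) / n * D) ^+ 2 * wb - L * pb.
Proof.
move=> Ha Hb Hp HX; rewrite -subr_gt0 contrast_aE contrast_bE.
set Z := (Bb + Ba * ((n - b) / (n - a))) * wb.
have -> : Bb ^+ 2 * wb + 2 * D * Bb + E2 - L * pb -
    (Ba ^+ 2 * wa + 2 * D * (Ba * ((n - b) / (n - a))) + r * E2 - L * pa) =
    (1 - r) * E2 + X * (2 * D + Z) - (1 - r) * (Ba ^+ 2 * wa) - L * (pb - pa).
  transitivity ((Bb ^+ 2 * wb - Ba ^+ 2 * wa) + 2 * D * X + (1 - r) * E2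
    - L * (pb - pa)); first by rewrite XE; ring.
  by rewrite sqr_diffE -/Z; ring.
have r1 : 0 < 1 - r by rewrite subr_gt0.
have ZD : `|Z| <= D / 4.
  have e : 0 <= 8^-1 :> R by rewrite invr_ge0.
  have /(small_b e) : Bb ^+ 2 * wb <= 8^-1 ^+ 2 * E2 by lra.
  have /(small_a e) : Ba ^+ 2 * wa <= 8^-1 ^+ 2 * E2 by lra.
  rewrite /Z (normrM _ wb) (gtr0_norm wb_gt0) => H1 H2.
  apply: (@le_trans _ _ ((`|Bb| + `|Ba * ((n - b) / (n - a))|) * wb)).
    by rewrite ler_wpM2r ?(ltW wb_gt0)// ler_normD.
  rewrite mulrDl; lra.
have XZ : `|X * (2 * D + Z)| <= 9 / 4 * (`|X| * D).
  rewrite (normrM X) mulrCA ler_wpM2l// (le_trans (ler_normD _ _))//.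
  rewrite gtr0_norm ?mulr_gt0//; lra.
have W : (1 - r) * (Ba ^+ 2 * wa) <= (1 - r) * E2 / 64.
  by rewrite -mulrA ler_pM2l.
have P0 : 0 < (1 - r) * E2 by rewrite mulr_gt0.
move: (ler_norm (- (X * (2 * D + Z)))) (ler_norm (L * (pb - pa))).
rewrite normrN => ? ?; lra.
Qed.

(** Splitting the square at [a] with weight [u] leaves at most 3/8 of [g * E2] net of penalty, while
    at least 3/4 of it remains at [b]. *)
Lemma contrast_lt_far u g C : 0 < u -> 0 < g < 1 ->
  (1 + u) * (Ba ^+ 2 * wa) <= L * pa + C -> (1 + u^-1) * r <= g / 4 ->
  Bb ^+ 2 * wb <= (g / 8) ^+ 2 * E2 -> L * pb <= (1 - g) * E2 ->
  C <= g * E2 / 8 ->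
  (Ba + a * (n - b) / n * D) ^+ 2 * wa - L * pa <
  (Bb + b * (n - b) / n * D) ^+ 2 * wb - L * pb.
Proof.
move=> u0 /andP[g0 g1] HC Hr Hb Hp HE.
have DB : `|Bb| * D <= g / 8 * E2.
  have g8 : 0 <= g / 8 by rewrite divr_ge0 ?ltW.
  have := small_b g8 Hb => H.
  have -> : `|Bb| * D = `|Bb| * wb * (D / wb) by field; rewrite gt_eqF.
  have -> : g / 8 * E2 = g / 8 * D * (D / wb).
    by case: nz => *; rewrite /E2 /wb; field; do ?[apply/andP; split].
  by rewrite ler_wpM2r// divr_ge0 ?(ltW D0) ?(ltW wb_gt0).
have BA : (Ba + a * (n - b) / n * D) ^+ 2 * wa <=
    (1 + u) * (Ba ^+ 2 * wa) + (1 + u^-1) * r * E2.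
  have -> : (1 + u) * (Ba ^+ 2 * wa) + (1 + u^-1) * r * E2 =
    (Ba + a * (n - b) / n * D) ^+ 2 * wa +
    u * (Ba - u^-1 * (a * (n - b) / n * D)) ^+ 2 * wa.
    case: nz => *; rewrite /r /E2 /wa; move: Ba => A.
    by field; do ?[apply/andP; split] => //; rewrite gt_eqF.
  by rewrite lerDl; apply: mulr_ge0 (ltW wa_gt0);
    apply: mulr_ge0 (ltW u0) (sqr_ge0 _).
rewrite contrast_bE.
have W : 0 <= Bb ^+ 2 * wb by exact: mulr_ge0 (sqr_ge0 _) (ltW wb_gt0).
have rE : (1 + u^-1) * r * E2 <= g / 4 * E2 by rewrite ler_pM2r.
have DB' : - (g / 8 * E2) <= D * Bb.
  by rewrite lerNl (le_trans (ler_norm _))// normrN normrM (gtr0_norm D0) mulrC.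
have gE : 0 < g * E2 by rewrite mulr_gt0.
have -> : 2 * D * Bb = 2 * (D * Bb) by ring.
lra.
Qed.

End contrast.

(** When [k] and [t] agree up to a factor [kap], [(k + t) ^+ 2 / (2 * t * k)] is at most twice the
    larger over the smaller. *)
Lemma sqr_div_le_ratio (R : realFieldType) (x k t kap S : R) :
  0 <= x -> 0 < k -> 0 < t -> 0 < kap <= 1 -> kap * k <= t -> kap * t <= k ->
  S ^+ 2 <= x * ((k + t) ^+ 2 / (2 * t)) -> S ^+ 2 / k <= 2 * x / kap.
Proof.
move=> x0 k0 t0 /andP[kap0 kap1] kt tk HS.
rewrite ler_pdivrMr// (le_trans HS)//.
have -> : 2 * x / kap * k = x * (2 * k / kap) by ring.
rewrite ler_wpM2l// ler_pdivrMr ?mulr_gt0//.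
rewrite mulrAC ler_pdivlMr//.
have [kt'|tk'] := leP k t; nra.
Qed.

Section contrast_lt.
Variables (R : realType) (L u g kap C cL : R).
Hypotheses (L12 : 1 < L <= 2) (u0 : 0 < u) (gE : g = 1 - L^-1).
Hypothesis kapE : (1 + u^-1) * kap = g / 4.
Hypothesis kap01 : 0 < kap <= 1.
Hypotheses (cL1 : 8 * C / g <= cL) (cL2 : 64 * 64 / kap <= cL)
  (cL3 : 8 * 64 / (kap * g ^+ 2) <= cL).

(** If [r < kap], [contrast_lt_far] applies. Otherwise the scales are comparable and
    [contrast_lt_close] applies once [X] is bounded: by the normalized noises if [r <= 1 / 2], else
    by the local bound on [Sb - Sa] and the size of [Sn - Sa]. *)
Lemma contrast_lt (x a b n D pa pb Sa Sb Sn : R) :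
  let E2 := D ^+ 2 * (b * (n - b) / n) in
  let r := a * (n - b) / (b * (n - a)) in
  0 < x -> 0 < a -> a < b -> b < n -> 0 < D -> 0 <= pb ->
  L ^+ 2 * pb + cL * (1 + x) <= E2 ->
  `|pb - pa| <= 2 * ln r^-1 ->
  Sa ^+ 2 <= x * ((a + b) ^+ 2 / (2 * b)) ->
  (Sn - Sa) ^+ 2 <= x * ((n - a + (n - b)) ^+ 2 / (2 * (n - b))) ->
  Sb ^+ 2 <= x * ((b + b) ^+ 2 / (2 * b)) ->
  (Sn - Sb) ^+ 2 <= x * ((n - b + (n - b)) ^+ 2 / (2 * (n - b))) ->
  (1 + u) * ((Sa - a / n * Sn) ^+ 2 * (n / (a * (n - a)))) <=
    L * pa + C * (1 + x) ->
  `|Sb - Sa| <= D * (b - a) / 32 + 16 * x / D ->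
  r <= 1 / 2 \/ 8 * 64 * x / D ^+ 2 < b - a ->
  (Sa - a / n * Sn + a * (n - b) / n * D) ^+ 2 * (n / (a * (n - a))) - L * pa <
  (Sb - b / n * Sn + b * (n - b) / n * D) ^+ 2 * (n / (b * (n - b))) - L * pb.
Proof.
move=> E2 r x0 a0 ab bn D0 pb0 hE lip hSa hSa' hSb hSb' hC hloc bad.
have /andP[L1 L2] := L12; have /andP[kap0 kap1] := kap01.
have L0 : 0 < L by rewrite (lt_trans _ L1).
have b0 : 0 < b by exact: lt_trans ab.
have n0 : 0 < n by exact: lt_trans bn.
have nb0 : 0 < n - b by rewrite subr_gt0.
have na0 : 0 < n - a by rewrite subr_gt0 (lt_trans ab).
have nz : [/\ a != 0, b != 0, n != 0, n - a != 0 & n - b != 0].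
  by split; rewrite gt_eqF.
have g01 : 0 < g < 1.
  by rewrite gE subr_gt0 ltrBlDr ltrDl invr_gt0 L0 invf_lt1// L1.
have /andP[g0 g1] := g01.
have xk0 : 0 < x / kap by rewrite divr_gt0.
have r_gt0 : 0 < r by rewrite divr_gt0// mulr_gt0.
have r_lt1 : r < 1.
  rewrite ltr_pdivrMr ?mulr_gt0// mul1r -subr_gt0.
  have -> : b * (n - a) - a * (n - b) = n * (b - a) by ring.
  by rewrite mulr_gt0// subr_gt0.
have cL0 : 0 < cL by rewrite (lt_le_trans _ cL2)// divr_gt0.
have E2x : cL * (1 + x) <= E2.
  by rewrite (le_trans _ hE)// lerDr mulr_ge0// sqr_ge0.
have E2k : 64 * 64 * (x / kap) <= E2.
  rewrite (le_trans _ E2x)//.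
  have -> : 64 * 64 * (x / kap) = 64 * 64 / kap * x by ring.
  by rewrite ler_pM// ?divr_ge0 ?ltW// ltrDr.
have E2_1 : 64 * 64 / kap <= E2.
  rewrite (le_trans cL2)// (le_trans _ E2x)// ler_peMr ?(ltW cL0)//.
  by rewrite lerDl ltW.
have E20 : 0 < E2 by rewrite (lt_le_trans _ E2_1)// divr_gt0.
have Nb : (Sb - b / n * Sn) ^+ 2 * (n / (b * (n - b))) <= 8 * (x / kap).
  have bn' : 0 < b < n by rewrite b0.
  have := bridge_sqr_le Sb (Sn - Sb) ltr01 bn'.
  rewrite addrCA subrr addr0 invr1 => H; apply: (le_trans H).
  have kk t : 0 < t -> kap * t <= t by move=> t0; rewrite ler_piMl ?(ltW t0).
  have := sqr_div_le_ratio (ltW x0) b0 b0 kap01 (kk _ b0) (kk _ b0) hSb.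
  have := sqr_div_le_ratio (ltW x0) nb0 nb0 kap01 (kk _ nb0) (kk _ nb0) hSb'.
  lra.
have [rk|kr] := ltP r kap.
  apply: (@contrast_lt_far _ a b n D L pa pb Sa Sb Sn a0 ab bn D0 u g
    (C * (1 + x))) => //.
  - by rewrite -kapE ler_pM2l ?(ltW rk)// addr_gt0// invr_gt0.
  - apply: (le_trans Nb); rewrite -/E2.
    have : 8 * 64 / (kap * g ^+ 2) * x <= E2.
      rewrite (le_trans _ E2x)// ler_pM// ?ltW// ?ltrDr//.
      by rewrite divr_gt0// mulr_gt0// exprn_gt0.
    rewrite -(ler_pM2l (_ : 0 < (g / 8) ^+ 2)) ?exprn_gt0 ?divr_gt0//.
    apply: le_trans; rewrite le_eqVlt; apply/orP; left; apply/eqP.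
    by field; rewrite !gt_eqF.
  (* Since [1 - g = L^-1], the goal is [L ^+ 2 * pb <= E2]: this is where the factor [L ^+ 2] of the
     energy condition is spent. *)
  - rewrite -/E2 gE; have -> : (1 - (1 - L^-1)) * E2 = L^-1 * E2 by ring.
    rewrite ler_pdivlMl// mulrA -expr2 (le_trans _ hE)// lerDl.
    by rewrite mulr_ge0 ?ltW// addr_gt0.
  - rewrite -/E2 ler_pdivlMr//.
    have -> : C * (1 + x) * 8 = g * (8 * C / g * (1 + x)).
      by field; rewrite gt_eqF.
    rewrite ler_pM2l// (le_trans _ E2x)// ler_wpM2r// ltW// addr_gt0//.
(* [r] is the product of [a / b] and [(n - b) / (n - a)], both below 1, so each of them is at least
   [kap]. *)
have ar : kap * b <= a.
  have : kap * (b * (n - a)) <= a * (n - b) by rewrite -ler_pdivlMr ?mulr_gt0.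
  nra.
have nr : kap * (n - a) <= n - b.
  have : kap * (b * (n - a)) <= a * (n - b) by rewrite -ler_pdivlMr ?mulr_gt0.
  nra.
have S'a : (Sn - Sa) ^+ 2 / (n - a) <= 2 * x / kap.
  apply: sqr_div_le_ratio hSa' => //; first exact: ltW.
  by rewrite (@le_trans _ _ (n - b)) ?ler_piMl ?(ltW nb0)// ltW// ltrD2l ltrN2.
have Na : (Sa - a / n * Sn) ^+ 2 * (n / (a * (n - a))) <= 8 * (x / kap).
  have an' : 0 < a < n by rewrite a0 (lt_trans ab).
  have := bridge_sqr_le Sa (Sn - Sa) ltr01 an'.
  rewrite addrCA subrr addr0 invr1 => H; apply: (le_trans H).
  have ka : kap * a <= b.
    by rewrite (@le_trans _ _ a) ?ler_piMl ?(ltW a0) ?(ltW ab).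
  have := sqr_div_le_ratio (ltW x0) a0 b0 kap01 ka ar hSa.
  lra.
have rE : (1 - r) * E2 = D ^+ 2 * ((b - a) * ((n - b) / (n - a))).
  by case: nz => *; rewrite /r /E2; field; do ?[apply/andP; split].
apply: contrast_lt_close => //; rewrite -/E2 -/r.
- by rewrite (le_trans Na)//; lra.
- by rewrite (le_trans Nb)//; lra.
- have r1 : 0 < 1 - r by rewrite subr_gt0.
  rewrite normrM gtr0_norm//.
  (* The penalty difference has to be of order [1 - r], like the loss of energy. *)
  have lnr : ln r^-1 <= (1 - r) / kap.
    rewrite (le_trans (_ : _ <= r^-1 - 1))//.
      have := @le_ln1Dx _ (r^-1 - 1); rewrite addrCA subrr addr0; apply.
      by rewrite ltrBrDr addrC subrr invr_gt0.
    have -> : r^-1 - 1 = (1 - r) / r by field; rewrite gt_eqF.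
    by rewrite ler_pM2l// lef_pV2.
  have : L * `|pb - pa| <= 2 * (2 * ((1 - r) / kap)).
    apply: ler_pM => //; first exact: ltW.
    by rewrite (le_trans lip)// ler_pM2l.
  move/le_trans; apply.
  have -> : (1 - r) * E2 / 64 = (1 - r) * (E2 / 64) by ring.
  have -> : 2 * (2 * ((1 - r) / kap)) = (1 - r) * (4 / kap) by ring.
  rewrite ler_pM2l//; have : 0 < kap^-1 by rewrite invr_gt0.
  by move: E2_1; lra.
- have [r2|r2] := leP r (1 / 2).
    apply: (@le_trans _ _ (3 / 16 * E2)); last first.
      by rewrite [leRHS]mulrA ler_wpM2r ?(ltW E20)//; lra.
    have E3 : 0 <= 3 / 16 * E2 by rewrite mulr_ge0 ?(ltW E20)//; lra.
    rewrite -(@ler_pXn2r _ 2) ?nnegrE ?(mulr_ge0 (normr_ge0 _) (ltW D0))//.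
    set X := Sb - Sa - _.
    rewrite (exprMn 2 `|_|) real_normK ?num_real//.
    set A := Sa - a / n * Sn in Na; set B := Sb - b / n * Sn in Nb.
    have XE : X = B - A * ((n - b) / (n - a)).
      by case: nz => *; rewrite /X /A /B; field; do ?[apply/andP; split].
    pose wb := n / (b * (n - b)).
    have DE : D ^+ 2 = wb * E2.
      by case: nz => *; rewrite /E2 /wb; field; do ?[apply/andP; split].
    have wb0 : 0 < wb by rewrite divr_gt0// mulr_gt0.
    have HX : X ^+ 2 * wb <= 32 * (x / kap).
      have sq (p q : R) : (p - q) ^+ 2 <= 2 * p ^+ 2 + 2 * q ^+ 2.
        by have := sqr_ge0 (p + q); lra.
      apply: (@le_trans _ _ ((2 * B ^+ 2 +
           2 * (A * ((n - b) / (n - a))) ^+ 2) * wb)).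
        by rewrite XE ler_wpM2r ?(ltW wb0).
      have -> : (2 * B ^+ 2 + 2 * (A * ((n - b) / (n - a))) ^+ 2) * wb =
          2 * (B ^+ 2 * wb) + 2 * (r * (A ^+ 2 * (n / (a * (n - a))))).
        case: nz => *; rewrite /r /wb.
        by field; do ?[apply/andP; split].
      have : r * (A ^+ 2 * (n / (a * (n - a)))) <= 8 * (x / kap).
        rewrite (le_trans _ Na)// ler_piMl ?(ltW r_lt1)//.
        by rewrite mulr_ge0 ?sqr_ge0// ltW// divr_gt0// mulr_gt0.
      by rewrite -/wb in Nb; lra.
    have -> : X ^+ 2 * D ^+ 2 = X ^+ 2 * wb * E2 by rewrite DE mulrA.
    apply: (le_trans (ler_wpM2r (ltW E20) HX)).
    have -> : (3 / 16 * E2) ^+ 2 = 9 / 256 * E2 * E2 by clearbody E2; field.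
    rewrite (ler_pM2r E20); lra.
  case: bad => [/(lt_le_trans r2)|bad]; first by rewrite ltxx.
  have ba0 : 0 < b - a by rewrite subr_gt0.
  (* The threshold 512 = 16 * 32 absorbs the intercept into the slope. The increment is then at most
     [D * (b - a) / 16], and [h2] adds twice as much, for a total of 3/16. *)
  have h1 : 16 * x / D <= D * (b - a) / 32.
    move: bad; rewrite ltr_pdivrMr ?exprn_gt0// ler_pdivrMr// expr2; lra.
  have h2 : `|Sn - Sa| <= D / 8 * (n - a).
    rewrite -(@ler_pXn2r _ 2) ?nnegrE ?mulr_ge0 ?divr_ge0 ?(ltW D0)
      ?(ltW na0)//.
    rewrite real_normK ?num_real//.
    move: S'a; rewrite ler_pdivrMr// => /le_trans; apply.
    have : E2 <= D ^+ 2 * (n - a).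
      rewrite ler_pM2l ?exprn_gt0// ler_pdivrMr// mulrC.
      by apply: ler_pM; rewrite ?ltW// ltrD2l ltrN2.
    move: E2k; set z := x / kap; have -> : 2 * x / kap = 2 * z by rewrite mulrA.
    move=> H1 H2.
    have -> : (D / 8 * (n - a)) ^+ 2 = D ^+ 2 * (n - a) / 64 * (n - a) by field.
    rewrite (ler_pM2r na0); have := le_trans H1 H2.
    have : 0 < z by []; lra.
  have nn : 1 / 2 <= (n - b) / (n - a).
    rewrite (le_trans (ltW r2))// /r -[leRHS]mul1r invfM mulrACA.
    rewrite ler_wpM2r ?divr_ge0 ?(ltW nb0) ?(ltW na0)//.
    by rewrite ler_pdivrMr// mul1r ltW.
  rewrite rE.
  apply: (@le_trans _ _ (3 / 16 * (D ^+ 2 * (b - a)))).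
    rewrite -ler_pdivlMr// (le_trans (ler_normB _ _))//.
    have -> : `|(b - a) / (n - a) * (Sn - Sa)| =
        (b - a) * (`|Sn - Sa| / (n - a)).
      by rewrite !normrM normfV (gtr0_norm ba0) (gtr0_norm na0) mulrAC mulrA.
    have h3 : `|Sn - Sa| / (n - a) <= D / 8 by rewrite ler_pdivrMr.
    have -> : 3 / 16 * (D ^+ 2 * (b - a)) / D = 3 / 16 * (D * (b - a)).
      by field; rewrite gt_eqF.
    have := ler_wpM2l (ltW ba0) h3; lra.
  have := ler_wpM2l (ltW ba0) nn.
  rewrite -(ler_pM2l (exprn_gt0 2 D0)); lra.
Qed.

End contrast_lt.

(** * The penalty *)

Section penalty.
Variables (R : realType) (n : nat).
Implicit Types (a b tau : nat) (s t l : R).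

Let trunc s := Num.min s (n%:R / s).

Definition pen_scale (tau : nat) : R :=
  Num.max (trunc tau%:R) (trunc (n.+1%:R - tau%:R)).

Lemma pen_scale_ge1 tau : (0 < tau <= n)%N -> 1 <= pen_scale tau.
Proof.
move=> /andP[t0 tn]; rewrite /pen_scale le_max /trunc le_min ler1n t0/=.
by rewrite ler_pdivlMr ?ltr0n// mul1r ler_nat tn.
Qed.

Lemma pen1E tau : (0 < tau <= n)%N ->
  pen1 R n tau = 2 * ln (1 + ln (pen_scale tau)).
Proof.
move=> /pen_scale_ge1 m1; rewrite /pen1 -/(trunc _) -/(trunc _).
by rewrite -/(pen_scale tau) lnM ?posrE ?expR_gt0 ?(lt_le_trans ltr01)// expRK.
Qed.

Lemma pen1_ge0 tau : (0 < tau <= n)%N -> 0 <= pen1 R n tau.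
Proof.
move=> tn; have m1 := pen_scale_ge1 tn.
by rewrite pen1E// mulr_ge0// ln_ge0// lerDl ln_ge0.
Qed.

(** Since [1 + ln s <= (1 + ln t) * (1 + ln l)] and [ln (1 + ln l) <= ln l], the iterated logarithm
    is 1-Lipschitz in the logarithm of the scale. *)
Lemma lnln_scale s t l : 1 <= s -> 1 <= t -> 1 <= l -> s <= l * t ->
  ln (1 + ln s) <= ln (1 + ln t) + ln l.
Proof.
move=> s1 t1 l1 slt.
have s0 : 0 < s := lt_le_trans ltr01 s1.
have t0 : 0 < t := lt_le_trans ltr01 t1.
have l0 : 0 < l := lt_le_trans ltr01 l1.
have lnt := ln_ge0 t1; have lns := ln_ge0 s1; have lnl := ln_ge0 l1.
have st : ln s <= ln l + ln t by rewrite -lnM// ler_ln// posrE mulr_gt0.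
have e : 1 + ln s <= (1 + ln t) * (1 + ln l) by nra.
apply: (@le_trans _ _ (ln ((1 + ln t) * (1 + ln l)))).
  by rewrite ler_ln// posrE ?mulr_gt0// ltr_wpDr.
rewrite lnM ?posrE ?ltr_wpDr// lerD2l.
by rewrite le_ln1Dx// (lt_le_trans _ lnl)// ltrN10.
Qed.

(** The penalty sees the scales [a + 1] and [n - a], the noise the times [a] and [n - a]: the factor
    2 between [k] and [s] absorbs the shift and costs [2 * ln 2]. The alternatives follow the
    smaller argument of the minimum. *)
Lemma pen_scale_lower a s : (0 < a < n)%N -> 1 <= s <= n%:R ->
  trunc s <= pen_scale a.+1 ->
  forall k, 1 <= k <= n%:R -> k <= s -> s <= 2 * k ->
  2 * ln (1 + ln k) <= pen1 R n a.+1 + 2 * ln 2 \/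
  2 * ln (1 + ln (n%:R / k)) <= pen1 R n a.+1 + 2 * ln 2.
Proof.
move=> /andP[a0 an] /andP[s1 sn] sm k /andP[k1 kn] ks sk.
have s0 : 0 < s := lt_le_trans ltr01 s1.
have k0 : 0 < k := lt_le_trans ltr01 k1.
have m1 : 1 <= pen_scale a.+1 by exact: pen_scale_ge1.
have two : 1 <= 2 :> R by rewrite ler1n.
rewrite pen1E// -!mulrDr !ler_pM2l//.
have [sns|nss] := leP s (n%:R / s); [left|right].
  apply: lnln_scale => //; rewrite (le_trans ks)//.
  move: sm; rewrite /trunc min_l// => /le_trans; apply.
  by rewrite ler_peMl// (le_trans _ m1).
apply: lnln_scale => //.
  by rewrite ler_pdivlMr// mul1r.
move: sm; rewrite /trunc min_r ?(ltW nss)// => sm.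
rewrite -(ler_pM2l (_ : 0 < 2 :> R)) // in sm.
apply: le_trans sm; rewrite ler_pdivrMr//.
have -> : 2 * (n%:R / s) * k = n%:R * (2 * k / s) by ring.
by rewrite ler_peMr ?ler0n// ler_pdivlMr// mul1r.
Qed.

Lemma pen1_lower_left a : (0 < a < n)%N ->
  2 * ln (1 + ln a%:R) <= pen1 R n a.+1 + 2 * ln 2 \/
  2 * ln (1 + ln (n%:R / a%:R)) <= pen1 R n a.+1 + 2 * ln 2.
Proof.
move=> /[dup] an /andP[a0 an'].
apply: (@pen_scale_lower a a.+1%:R an).
- by rewrite ler1n ler_nat an'.
- by rewrite /pen_scale le_max lexx.
- by rewrite ler1n a0 ler_nat ltnW.
- by rewrite ler_nat.
- by rewrite -natrM ler_nat mul2n -addnn -addn1 leq_add2l.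
Qed.

Lemma pen1_lower_right a : (0 < a < n)%N ->
  2 * ln (1 + ln (n - a)%:R) <= pen1 R n a.+1 + 2 * ln 2 \/
  2 * ln (1 + ln (n%:R / (n - a)%:R)) <= pen1 R n a.+1 + 2 * ln 2.
Proof.
move=> /[dup] an /andP[a0 an'].
have k1 : 1 <= ((n - a)%:R : R) by rewrite ler1n subn_gt0.
have kn : ((n - a)%:R : R) <= n%:R by rewrite ler_nat leq_subr.
apply: (@pen_scale_lower a (n - a)%:R an); rewrite ?k1 ?kn//.
- by rewrite /pen_scale le_max -natrB 1?ltnW// subSS lexx orbT.
- by rewrite ler_peMl ?ler0n// ler1n.
Qed.

Let trunc_scale s t l : 0 < s -> 0 < t -> s <= l * t -> t <= l * s ->
  trunc s <= l * trunc t.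
Proof.
move=> s0 t0 slt tls; rewrite /trunc; have [tnt|ntt] := leP t (n%:R / t).
  by rewrite ge_min slt.
rewrite ge_min; apply/orP; right.
rewrite ler_pdivrMr//.
have -> : l * (n%:R / t) * s = n%:R * (l * s / t) by ring.
by rewrite ler_peMr ?ler0n// ler_pdivlMr// mul1r.
Qed.

(** The inverse ratio is [(b / a) * ((n - a) / (n - b))], with both factors at least 1, so it
    dominates the ratio of scales on either side; [lnln_scale] is used in both directions. *)
Lemma pen1_lip a b : (0 < a)%N -> (a < b < n)%N ->
  `|pen1 R n b.+1 - pen1 R n a.+1| <=
  2 * ln ((a%:R * (n%:R - b%:R) / (b%:R * (n%:R - a%:R)))^-1).
Proof.
move=> a0 /andP[ab bn]; set l := (_ / _)^-1.
have ra0 : 0 < a%:R :> R by rewrite ltr0n.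
have rab : a%:R < b%:R :> R by rewrite ltr_nat.
have rbn : b%:R < n%:R :> R by rewrite ltr_nat.
have rb0 : 0 < b%:R :> R := lt_trans ra0 rab.
have nb0 : 0 < n%:R - b%:R :> R by rewrite subr_gt0.
have na0 : 0 < n%:R - a%:R :> R by rewrite subr_gt0 (lt_trans rab).
have lE : l = (b%:R / a%:R) * ((n%:R - a%:R) / (n%:R - b%:R)).
  by rewrite /l; field; do ?[apply/andP; split]; rewrite gt_eqF.
have q1 : 1 <= b%:R / a%:R :> R by rewrite ler_pdivlMr// mul1r ltW.
have q2 : 1 <= (n%:R - a%:R) / (n%:R - b%:R) :> R.
  by rewrite ler_pdivlMr// mul1r lerD2l lerN2 ltW.
have l1 : 1 <= l by rewrite lE -[leLHS]mul1r ler_pM.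
have l0 : 0 < l := lt_le_trans ltr01 l1.
have s1 k : 0 < k.+1%:R :> R by rewrite ltr0n.
have lb : b%:R <= l * a%:R.
  by rewrite lE [leRHS]mulrAC divfK ?gt_eqF// ler_peMr// ltW.
have lnb : n%:R - a%:R <= l * (n%:R - b%:R).
  by rewrite lE -mulrA divfK ?gt_eqF// ler_peMl// ltW.
have S1 k : n.+1%:R - k.+1%:R = n%:R - k%:R :> R by rewrite -!natr1; ring.
have up1 : b.+1%:R <= l * a.+1%:R.
  by rewrite -!natr1 mulrDr mulr1 lerD.
have le_l t : 0 <= t -> t <= l * t by move=> t0; rewrite ler_peMl.
have up2 : a.+1%:R <= l * b.+1%:R.
  by rewrite (le_trans _ (le_l _ _))// ler_nat ltnS ltnW.
have up3 : n%:R - b%:R <= l * (n%:R - a%:R).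
  by rewrite (le_trans _ (le_l _ (ltW na0)))// lerD2l lerN2 ltW.
have mab : pen_scale a.+1 <= l * pen_scale b.+1.
  rewrite /pen_scale !S1 maxr_pMr ?(ltW l0)// ge_max !le_max.
  by rewrite (trunc_scale (s1 a) (s1 b) up2 up1)
    (trunc_scale na0 nb0 lnb up3) orbT.
have mba : pen_scale b.+1 <= l * pen_scale a.+1.
  rewrite /pen_scale !S1 maxr_pMr ?(ltW l0)// ge_max !le_max.
  by rewrite (trunc_scale (s1 b) (s1 a) up1 up2)
    (trunc_scale nb0 na0 up3 lnb) orbT.
have an : (0 < a.+1 <= n)%N by exact: ltn_trans bn.
have bn' : (0 < b.+1 <= n)%N by [].
have ma1 := pen_scale_ge1 an; have mb1 := pen_scale_ge1 bn'.
rewrite !pen1E// -mulrBr normrM ger0_norm// ler_pM2l// ler_norml.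
have := lnln_scale ma1 mb1 l1 mab; have := lnln_scale mb1 ma1 l1 mba.
by move=> ? ?; apply/andP; split; lra.
Qed.

End penalty.

(** * The law of the iterated logarithm *)

Section scales.
Variable R : realType.
Implicit Types (x y u q s t : R) (j k M : nat).

(** Union-bound weights: scale [j] gets probability proportional to the power [- (1 + u)] of
    [j + 1], and the constant normalizes the sum. *)
Definition level u x j : R := x + ln ((1 + u) / u) + (1 + u) * ln j.+1%:R.

Lemma level_const_ge0 u : 0 < u -> 0 <= ln ((1 + u) / u).
Proof. by move=> u0; rewrite ln_ge0// ler_pdivlMr// mul1r lerDr. Qed.

Lemma level_gt0 u x j : 0 < u -> 0 < x -> 0 < level u x j.
Proof.
move=> u0 x0; rewrite /level -addrA ltr_wpDr// addr_ge0 ?level_const_ge0//.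
by rewrite mulr_ge0 ?addr_ge0 ?(ltW u0)// ln_ge0// ler1n.
Qed.

(** A discrete comparison with the integral of a power, from
    [ln (k + 2) - ln (k + 1) >= 1 / (k + 2)] and convexity of the exponential. *)
Lemma power_tail_step u k : 0 < u ->
  u * expR (- ((1 + u) * ln k.+2%:R)) <=
  expR (- (u * ln k.+1%:R)) - expR (- (u * ln k.+2%:R)) :> R.
Proof.
move=> u0; set c := ln k.+1%:R; set e := ln k.+2%:R.
have k0 : 0 < k.+2%:R :> R by rewrite ltr0n.
have ec : (k.+2%:R)^-1 <= e - c.
  rewrite /e /c -ln_div ?posrE ?ltr0n//.
  have -> : k.+2%:R / k.+1%:R = (1 + - (k.+2%:R)^-1)^-1 :> R.
    have -> : 1 + - (k.+2%:R)^-1 = k.+1%:R / k.+2%:R :> R.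
      rewrite -[k.+2%:R]natr1; field.
      by apply: lt0r_neq0; have := ler0n R k; lra.
    by rewrite invf_div.
  rewrite lnV ?posrE; last by rewrite subr_gt0 invf_lt1// ltr1n.
  by rewrite lerNr le_ln1Dx// ltrN2 invf_lt1// ltr1n.
have -> : expR (- (u * c)) = expR (- (u * e)) * expR (u * (e - c)).
  by rewrite -expRD; congr expR; ring.
have -> : expR (- ((1 + u) * e)) = expR (- (u * e)) * (k.+2%:R)^-1.
  rewrite -[in RHS](lnK (k0 : _ \is Num.pos)) -expRN -expRD; congr expR.
  by rewrite -/e; ring.
rewrite mulrCA -[X in _ <= _ - X]mulr1 -mulrBr ler_pM2l ?expR_gt0//.
rewrite (@le_trans _ _ (u * (e - c)))// ?ler_pM2l//.
by rewrite lerBrDl expR_ge1Dx.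
Qed.

Lemma sum_level_le u x M : 0 < u ->
  \sum_(j < M) expR (- level u x j) <= expR (- x).
Proof.
move=> u0; have u1 : 0 < 1 + u by rewrite addr_gt0.
have H k : u * (\sum_(j < k.+1) expR (- ((1 + u) * ln j.+1%:R))) <=
    1 + u - expR (- (u * ln k.+1%:R)).
  elim: k => [|k IH].
    by rewrite big_ord1 ln1 !mulr0 oppr0 expR0; lra.
  by rewrite big_ord_recr/= mulrDr; have := @power_tail_step u k u0; lra.
have {}H : \sum_(j < M) expR (- ((1 + u) * ln j.+1%:R)) <= (1 + u) / u.
  case: M => [|k]; first by rewrite big_ord0 divr_ge0 ?ltW.
  rewrite ler_pdivlMr// mulrC (le_trans (H k))//.
  by rewrite gerBl expR_ge0.
have uu : 0 < (1 + u) / u by rewrite divr_gt0.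
have E j : expR (- level u x j) =
    expR (- x) * (((1 + u) / u)^-1 * expR (- ((1 + u) * ln j.+1%:R))).
  by rewrite /level !opprD !expRD (expRN (ln ((1 + u) / u))) lnK// -mulrA.
under eq_bigr do rewrite E.
rewrite -!mulr_sumr ler_piMr ?expR_ge0//.
by rewrite ler_pdivrMl// mulr1.
Qed.

Lemma geometric_scale q s M : 1 < q -> 1 <= s -> s < q ^+ M ->
  exists2 j, (j < M)%N & q ^+ j <= s < q ^+ j.+1.
Proof.
move=> q1 s1; elim: M => [|M IH]; first by rewrite expr0 ltNge s1.
have [qs sq|/IH[j jM js] _] := leP (q ^+ M) s; first by exists M; rewrite ?qs.
by exists j => //; rewrite ltnW.
Qed.

(** From [j * ln q <= ln s] and [ln q <= 1], [(j + 1) * ln q <= 1 + ln s]: the price of the index is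
    half the penalty of its scale, up to a constant. *)
Lemma scale_index_le q s j : 1 < q -> ln q <= 1 -> 1 <= s -> q ^+ j <= s ->
  ln j.+1%:R <= ln (1 + ln s) - ln (ln q).
Proof.
move=> q1 lq s1 qs; have q0 : 0 < q := lt_trans ltr01 q1.
have s0 : 0 < s := lt_le_trans ltr01 s1.
have lq0 : 0 < ln q by rewrite ln_gt0.
have ls := ln_ge0 s1.
rewrite -ln_div ?posrE// ?ltr_wpDr//.
rewrite ler_ln ?posrE ?ltr0n// ?divr_gt0 ?ltr_wpDr// ler_pdivlMr//.
have : ln (q ^+ j) <= ln s by rewrite ler_ln ?posrE// exprn_gt0.
by rewrite lnXn// -natr1 mulrDl mul1r -mulr_natl => ?; lra.
Qed.

(** Bernoulli's inequality. [M] only makes the union over scales finite; it enters no constant. *)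
Lemma exists_scale_bound q (n : nat) : 1 < q -> exists M, n%:R < q ^+ M.
Proof.
move=> q1; have [M HM] : exists M : nat, n%:R / (q - 1) < M%:R.
  exists (Num.bound (n%:R / (q - 1))).
  by apply: archi_boundP; rewrite divr_ge0// subr_ge0 ltW.
exists M; rewrite ltr_pdivrMr ?subr_gt0// in HM; apply: (lt_le_trans HM).
suff : 1 + M%:R * (q - 1) <= q ^+ M by lra.
elim: M {HM} => [|k IH]; first by rewrite mul0r addr0 expr0.
rewrite exprS -natr1; have : 0 <= k%:R * (q - 1) ^+ 2.
  by rewrite mulr_ge0 ?sqr_ge0.
have q0 : 0 < q := lt_trans ltr01 q1.
by rewrite -(ler_pM2l q0) in IH => ?; lra.
Qed.

(** Each bound is the square of the line that is lowest at time [t], for [t = q ^+ j] and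
    [t = n / q ^+ j]. The grid from [n] serves the times for which the penalty only pays for
    [n / k]. *)
Definition within_scales u x q (n M : nat) (S : nat -> R) : Prop :=
  forall j, (j < M)%N -> forall k, (k <= n)%N ->
  S k ^+ 2 <= level u x j * ((k%:R + q ^+ j) ^+ 2 / (2 * q ^+ j)) /\
  S k ^+ 2 <=
    level u x j * ((k%:R + n%:R / q ^+ j) ^+ 2 / (2 * (n%:R / q ^+ j))).

Lemma sqr_div_le_scale q k t y s : 0 < k%:R :> R -> 0 < t -> 0 <= y ->
  k%:R <= q * t -> t <= k%:R \/ k%:R <= t /\ t <= q * k%:R -> 1 <= q ->
  s ^+ 2 <= y * ((k%:R + t) ^+ 2 / (2 * t)) -> s ^+ 2 / k%:R <= y * (q + 3) / 2.
Proof.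
move=> k0 t0 y0 kt tk q1 H; rewrite ler_pdivrMr// (le_trans H)//.
have -> : y * (q + 3) / 2 * k%:R = y * ((q + 3) / 2 * k%:R) by ring.
rewrite ler_wpM2l// ler_pdivrMr ?mulr_gt0//.
by case: tk => [tk|[tk tk']]; nra.
Qed.

(** A scale within a factor [q] of [k] is taken from the grid that the penalty pays for;
    [q = 1 + 4 * u] makes the loss [(q + 3) / 2] equal to [2 * (1 + u)]. *)
Lemma lil_bound u x q (n M k : nat) S p : 0 < u -> 0 < x -> q = 1 + 4 * u ->
  4 * u <= 1 -> n%:R < q ^+ M -> (0 < k < n)%N -> within_scales u x q n M S ->
  2 * ln (1 + ln k%:R) <= p \/ 2 * ln (1 + ln (n%:R / k%:R)) <= p ->
  S k ^+ 2 / k%:R <=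
  (1 + u) * (2 * (x + ln ((1 + u) / u)) + (1 + u) * (p - 2 * ln (ln q))).
Proof.
move=> u0 x0 qE u1 nM /andP[k0 kn] HS Hp.
have q1 : 1 < q by rewrite qE ltrDl mulr_gt0.
have q0 : 0 < q := lt_trans ltr01 q1.
have lq : ln q <= 1.
  rewrite qE (le_trans _ u1)// le_ln1Dx// (lt_trans (ltrN10 _))// mulr_gt0//.
have rk0 : 0 < k%:R :> R by rewrite ltr0n.
have rk1 : 1 <= k%:R :> R by rewrite ler1n.
have rkn : k%:R <= n%:R :> R by rewrite ler_nat ltnW.
have rn0 : 0 < n%:R :> R := lt_le_trans rk0 rkn.
suff [j H1 H2] : exists2 j, 2 * ln j.+1%:R <= p - 2 * ln (ln q) &
    S k ^+ 2 / k%:R <= level u x j * (q + 3) / 2.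
  rewrite (le_trans H2)// /level qE.
  have -> : (x + ln ((1 + u) / u) + (1 + u) * ln j.+1%:R) * (1 + 4 * u + 3) / 2
     = (1 + u) * (2 * (x + ln ((1 + u) / u)) + (1 + u) * (2 * ln j.+1%:R)).
    by field.
  by rewrite !(ler_pM2l, lerD2l) ?addr_gt0// -qE.
case: Hp => Hp.
  have [j jM /andP[j1 j2]] := geometric_scale q1 rk1 (le_lt_trans rkn nM).
  exists j.
    by have := scale_index_le q1 lq rk1 j1; lra.
  have [H _] := HS j jM k (ltnW kn).
  apply: sqr_div_le_scale H => //.
  - by rewrite exprn_gt0.
  - by rewrite ltW// level_gt0.
  - by rewrite -exprS ltW.
  - by left.
  - exact: ltW.
have s1 : 1 <= n%:R / k%:R :> R by rewrite ler_pdivlMr// mul1r.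
have sM : n%:R / k%:R < q ^+ M.
  by rewrite (le_lt_trans _ nM)// ler_pdivrMr// ler_peMr// ltW.
have [j jM /andP[j1 j2]] := geometric_scale q1 s1 sM.
have qj0 : 0 < q ^+ j by rewrite exprn_gt0.
have e1 : k%:R <= n%:R / q ^+ j.
  by rewrite ler_pdivlMr// mulrC -ler_pdivlMr.
exists j.
  by have := scale_index_le q1 lq s1 j1; lra.
have [_ H] := HS j jM k (ltnW kn).
apply: sqr_div_le_scale H => //.
- by rewrite divr_gt0.
- by rewrite ltW// level_gt0.
- by rewrite (le_trans e1)// ler_peMl ?ltW// divr_gt0.
- right; split=> //; rewrite ler_pdivrMr// mulrAC -exprS.
  by rewrite -ler_pdivrMr// ltW.
- exact: ltW.
Qed.

End scales.

(** * The event on which the noise is controlled *)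

Section noise_event.
Context d (T : measurableType d) (R : realType) (P : probability T R).
Variables (n : nat) (eps : 'I_n -> {RV P >-> R}).
Hypothesis ind : independent_rvs P eps.
Hypothesis sub : forall i, subgaussian (eps i).
Hypothesis n0 : (0 < n)%N.

Let noise w := psum (eps ^~ w).

(** The slope parameter [Num.sqrt (2 * y / t)] minimizes the height of the line at time [t]. *)
Lemma sqr_line (t y s k : R) : 0 < t -> 0 < y ->
  `|s| <= Num.sqrt (2 * y / t) * k / 2 + y / Num.sqrt (2 * y / t) ->
  s ^+ 2 <= y * ((k + t) ^+ 2 / (2 * t)).
Proof.
move=> t0 y0; have yt : 0 < 2 * y / t by rewrite divr_gt0// mulr_gt0.
set l := Num.sqrt _; have l0 : 0 < l by rewrite sqrtr_gt0.
have l2 : l ^+ 2 = 2 * y / t by rewrite sqr_sqrtr// ltW.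
move=> H; have H0 : 0 <= l * k / 2 + y / l by exact: le_trans H.
have : `|s| ^+ 2 <= (l * k / 2 + y / l) ^+ 2 by rewrite ler_pXn2r ?nnegrE.
rewrite real_normK ?num_real// => /le_trans; apply.
have -> : (l * k / 2 + y / l) ^+ 2 =
    l ^+ 2 * k ^+ 2 / 4 + y * k + y ^+ 2 / l ^+ 2.
  by field; rewrite gt_eqF.
rewrite l2 le_eqVlt; apply/orP; left; apply/eqP; field.
by rewrite !gt_eqF.
Qed.

Lemma noise_sqr_forward t y : 0 < t -> 0 < y ->
  outside_bad P (2 * expR (- y)) (fun w => forall k, (k <= n)%N ->
    noise w k ^+ 2 <= y * ((k%:R + t) ^+ 2 / (2 * t))).
Proof.
move=> t0 y0; have l0 : 0 < Num.sqrt (2 * y / t).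
  by rewrite sqrtr_gt0 divr_gt0// mulr_gt0.
apply: (outside_bad_sub (lexx _) _ (psum_forward_line ind sub y l0 n0)).
move=> w H k kn; apply: sqr_line => //.
by have := H k; rewrite add0n psum0 subr0; exact.
Qed.

Lemma noise_sqr_backward t y : 0 < t -> 0 < y ->
  outside_bad P (2 * expR (- y)) (fun w => forall k, (k <= n)%N ->
    (noise w n - noise w (n - k)) ^+ 2 <= y * ((k%:R + t) ^+ 2 / (2 * t))).
Proof.
move=> t0 y0; have l0 : 0 < Num.sqrt (2 * y / t).
  by rewrite sqrtr_gt0 divr_gt0// mulr_gt0.
have nn : (0 < n <= n)%N by rewrite n0 leqnn.
apply: (outside_bad_sub (lexx _) _ (psum_backward_line ind sub y l0 nn)).
by move=> w H k kn; apply: sqr_line => //; exact: H.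
Qed.

Lemma within_scales_outside_bad (S : T -> nat -> R) u x q M :
  (forall t y, 0 < t -> 0 < y ->
    outside_bad P (2 * expR (- y)) (fun w => forall k, (k <= n)%N ->
      S w k ^+ 2 <= y * ((k%:R + t) ^+ 2 / (2 * t)))) ->
  0 < u -> 0 < x -> 1 < q ->
  outside_bad P (4 * expR (- x)) (fun w => within_scales u x q n M (S w)).
Proof.
move=> HS u0 x0 q1; have q0 : 0 < q := lt_trans ltr01 q1.
have rn0 : 0 < n%:R :> R by rewrite ltr0n.
have H j : outside_bad P (4 * expR (- level u x j)) (fun w =>
    forall k, (k <= n)%N ->
  S w k ^+ 2 <= level u x j * ((k%:R + q ^+ j) ^+ 2 / (2 * q ^+ j)) /\
  S w k ^+ 2 <=
    level u x j * ((k%:R + n%:R / q ^+ j) ^+ 2 / (2 * (n%:R / q ^+ j)))).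
  have y0 := @level_gt0 _ u x j u0 x0.
  have qj0 : 0 < q ^+ j by rewrite exprn_gt0.
  have := outside_badI (HS _ _ qj0 y0) (HS _ _ (divr_gt0 rn0 qj0) y0).
  apply: outside_bad_sub; first by lra.
  by move=> w [H1 H2] k kn; split; [exact: H1|exact: H2].
apply: (outside_bad_sub _ _ (outside_bad_forall M H)) => //.
by rewrite -mulr_sumr ler_pM2l// sum_level_le.
Qed.

(** In units of [expR (- x)], the grids cost 4 in each direction of time and each of the four single
    lines costs 2, hence 16. *)
Lemma noise_outside_bad b u x q M D : (0 < b < n)%N ->
  0 < u -> 0 < x -> 1 < q -> 0 < D ->
  outside_bad P (16 * expR (- x)) (fun w =>
    let S := noise w in let Sr k := S n - S (n - k)%N in
    [/\ within_scales u x q n M S, within_scales u x q n M Sr,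
      (forall k, (k <= n)%N ->
         S k ^+ 2 <= x * ((k%:R + b%:R) ^+ 2 / (2 * b%:R))),
      (forall k, (k <= n)%N ->
         Sr k ^+ 2 <= x * ((k%:R + (n - b)%:R) ^+ 2 / (2 * (n - b)%:R)))
    & forall a, (a <= n)%N ->
         `|S b - S a| <= D * `|b%:R - a%:R| / 32 + 16 * x / D]).
Proof.
move=> /andP[b0 bn] u0 x0 q1 D0.
have l0 : 0 < D / 16 by rewrite divr_gt0.
have rb0 : 0 < b%:R :> R by rewrite ltr0n.
have rnb0 : 0 < (n - b)%:R :> R by rewrite ltr0n subn_gt0.
have bn' : (0 < b <= n)%N by rewrite b0 ltnW.
have := outside_badI (outside_badI (outside_badI (outside_badI (outside_badI
  (within_scales_outside_bad M noise_sqr_forward u0 x0 q1)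
  (within_scales_outside_bad M noise_sqr_backward u0 x0 q1))
  (noise_sqr_forward rb0 x0)) (noise_sqr_backward rnb0 x0))
  (psum_forward_line ind sub x l0 bn)) (psum_backward_line ind sub x l0 bn').
apply: outside_bad_sub; first by lra.
move=> w [[[[[H1 H2] H3] H4] H5] H6] S Sr; split=> // a an.
have e (z : R) : D / 16 * z / 2 + x / (D / 16) = D * z / 32 + 16 * x / D.
  by field; rewrite gt_eqF.
have [ab|ba] := leqP a b.
  have := H6 (b - a)%N (leq_subr _ _); rewrite subKn// e natrB//.
  by rewrite (ger0_norm (_ : 0 <= b%:R - a%:R))// subr_ge0 ler_nat.
have := H5 (a - b)%N; rewrite (subnKC (ltnW ba)) => /(_ an).
rewrite e (natrB _ (ltnW ba)) (distrC (S b)) (distrC b%:R).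
by rewrite (ger0_norm (_ : 0 <= a%:R - b%:R))// subr_ge0 ler_nat ltnW.
Qed.

End noise_event.

(** * Normalized noise against the penalty *)

Section penalised_contrast.
Variable R : realType.

(** Only the shorter piece needs the iterated logarithm. The four factors [1 + u] come from the
    prefactor, the splitting of the bridge, the grid ratio and the weights. *)
Lemma noise_cusum_le (L u x q : R) (n M a : nat) (S Sr : nat -> R) (pa : R) :
  let c := ln ((1 + u) / u) in let c' := 2 * ln 2 - 2 * ln (ln q) in
  let C := L * c' + (2 * (1 + u) ^+ 3 + 4 * (1 + u) ^+ 2 / u) * (1 + c) in
  0 < u -> 0 < x -> q = 1 + 4 * u -> 4 * u <= 1 -> (1 + u) ^+ 4 <= L ->
  n%:R < q ^+ M -> (0 < a < n)%N -> (2 * a <= n)%N -> 0 <= pa ->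
  within_scales u x q n M S -> within_scales u x q n M Sr ->
  2 * ln (1 + ln a%:R) <= pa + 2 * ln 2 \/
  2 * ln (1 + ln (n%:R / a%:R)) <= pa + 2 * ln 2 ->
  S n = S a + Sr (n - a)%N ->
  (1 + u) * ((S a - a%:R / n%:R * S n) ^+ 2 *
    (n%:R / (a%:R * (n%:R - a%:R)))) <= L * pa + C * (1 + x).
Proof.
move=> c c' C u0 x0 qE u1 uL nM an an2 pa0 HS HSr Hp SE.
have /andP[a0 an'] := an.
have ra0 : 0 < a%:R :> R by rewrite ltr0n.
have ran : a%:R < n%:R :> R by rewrite ltr_nat.
have rn0 : 0 < n%:R :> R := lt_trans ra0 ran.
have rna : 0 < n%:R - a%:R :> R by rewrite subr_gt0.
have c0 : 0 <= c by exact: level_const_ge0.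
have q1 : 1 < q by rewrite qE ltrDl mulr_gt0.
have lq : ln q <= 1.
  by rewrite qE (le_trans _ u1)// le_ln1Dx// (lt_trans (ltrN10 _))// mulr_gt0.
have lnq0 : ln (ln q) <= 0.
  by rewrite ln_le0.
have c'0 : 0 <= c'.
  have : 0 <= ln 2 :> R by rewrite ln_ge0// ler1n.
  by rewrite /c'; lra.
have HX := lil_bound u0 x0 qE u1 nM an HS Hp.
have M0 : (0 < M)%N.
  case: (M) nM => //; rewrite expr0 => n1.
  have : 1 <= n%:R :> R by rewrite ler1n (leq_trans a0)// ltnW.
  by rewrite leNgt n1.
have HY : Sr (n - a)%N ^+ 2 / (n%:R - a%:R) <= 4 * (x + c).
  (* The longer piece has length at least [n / 2], so the scale [n], of index 0 and without
     logarithmic cost, is enough. *)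
  have [_] := HSr 0%N M0 (n - a)%N (leq_subr _ _).
  rewrite expr0 divr1 /level ln1 mulr0 addr0 -/c (natrB _ (ltnW an')).
  have n2a : 2 * a%:R <= n%:R :> R by rewrite -natrM ler_nat.
  rewrite ler_pdivrMr// => /le_trans; apply.
  have -> : 4 * (x + c) * (n%:R - a%:R) = (x + c) * (4 * (n%:R - a%:R)) by ring.
  rewrite ler_wpM2l ?addr_ge0 ?(ltW x0)//.
  rewrite ler_pdivrMr ?mulr_gt0//; nra.
have an2' : (0 < a%:R :> R) && (a%:R < n%:R :> R) by rewrite ra0.
have HN := bridge_sqr_le (S a) (Sr (n - a)%N) u0 an2'.
rewrite -SE in HN.
have u10 : 0 < 1 + u by rewrite addr_gt0.
apply: (le_trans (ler_wpM2l (ltW u10) HN)); clear HN.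
move: HX HY; set X := _ / a%:R; set Y := _ / (_ - _) => HX HY.
have -> : (1 + u) * ((1 + u) * X + (1 + u^-1) * Y) =
    (1 + u) ^+ 2 * X + (1 + u) ^+ 2 / u * Y.
  by clearbody X Y; field; rewrite gt_eqF.
apply: (@le_trans _ _ ((1 + u) ^+ 4 * (pa + c')
    + (2 * (1 + u) ^+ 3 + 4 * (1 + u) ^+ 2 / u) * (x + c))).
  have -> : (1 + u) ^+ 4 * (pa + c')
    + (2 * (1 + u) ^+ 3 + 4 * (1 + u) ^+ 2 / u) * (x + c) =
    (1 + u) ^+ 2 * ((1 + u) * (2 * (x + c) +
       (1 + u) * (pa + 2 * ln 2 - 2 * ln (ln q)))) +
    (1 + u) ^+ 2 / u * (4 * (x + c)).
    by rewrite /c'; field; rewrite gt_eqF.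
  by rewrite lerD// ler_wpM2l// ?divr_ge0 ?exprn_ge0 ?ltW.
have K0 : 0 <= 2 * (1 + u) ^+ 3 + 4 * (1 + u) ^+ 2 / u.
  by rewrite addr_ge0 ?divr_ge0 ?mulr_ge0 ?exprn_ge0 ?ltW.
have L0 : 0 <= L by rewrite (le_trans _ uL)// exprn_ge0// ltW.
rewrite /C; set K := 2 * (1 + u) ^+ 3 + _ in K0 *.
have h1 : (1 + u) ^+ 4 * (pa + c') <= L * (pa + c').
  by rewrite ler_wpM2r// addr_ge0.
have h2 : K * (x + c) <= K * (1 + c) * (1 + x).
  by rewrite -mulrA ler_wpM2l//; have := mulr_ge0 c0 (ltW x0); lra.
have h3 : 0 <= L * c' * x by rewrite !mulr_ge0// ltW.
by lra.
Qed.

End penalised_contrast.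

(** * Misplaced change-points *)

Section one_side.
Variables (R : realType) (L : R).
Hypothesis L12 : 1 < L <= 2.

(* (1 + u)^4 <= L for u = slack pays for the grid of ratio q = 1 + 4 u, for the
   summable weights (j + 1)^-(1 + u) and for two splittings of squares;
   far_ratio solves (1 + 1/u) far_ratio = gap / 4. *)
Definition slack : R := (L - 1) / 15.
Definition gap : R := 1 - L^-1.
Definition far_ratio : R := gap * slack / (4 * (1 + slack)).
Definition scale_ratio : R := 1 + 4 * slack.
Definition noise_const : R :=
  L * (2 * ln 2 - 2 * ln (ln scale_ratio)) +
  (2 * (1 + slack) ^+ 3 + 4 * (1 + slack) ^+ 2 / slack) *
  (1 + ln ((1 + slack) / slack)).
Definition energy_const : R :=
  8 * noise_const / gap + 64 * 64 / far_ratio + 8 * 64 / (far_ratio * gap ^+ 2).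

Let u := slack.
Let q := scale_ratio.

Lemma slack_gt0 : 0 < slack.
Proof. by rewrite /slack; case/andP: L12 => *; lra. Qed.

Lemma slack_le : 4 * slack <= 1.
Proof. by rewrite /slack; case/andP: L12 => *; lra. Qed.

(** The chord of the convex function [(1 + v) ^+ 4] between 0 and 1 is [1 + 15 * v]; this explains
    the 15 in [slack]. *)
Lemma slack_pow4 : (1 + slack) ^+ 4 <= L.
Proof.
have -> : L = 1 + 15 * slack by rewrite /slack; field.
have := slack_gt0; have := slack_le; move: slack => v v1 v0.
have : 0 <= v * (1 - 4 * v) by rewrite mulr_ge0 ?(ltW v0)// subr_ge0.
nra.
Qed.

Lemma scale_ratio_gt1 : 1 < scale_ratio.
Proof. by rewrite ltrDl mulr_gt0// slack_gt0. Qed.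

Lemma gap_bounds : 0 < gap < 1.
Proof.
case/andP: L12 => L1 _; have L0 : 0 < L := lt_trans ltr01 L1.
by rewrite /gap subr_gt0 ltrBlDr ltrDl invr_gt0 L0 invf_lt1// L1.
Qed.

Lemma far_ratio_bounds : 0 < far_ratio <= 1.
Proof.
have u0 := slack_gt0; have /andP[g0 g1] := gap_bounds.
have d0 : 0 < 4 * (1 + slack) by rewrite mulr_gt0// addr_gt0.
apply/andP; split; first by rewrite divr_gt0// mulr_gt0.
rewrite /far_ratio ler_pdivrMr// mul1r.
have : gap * slack <= slack by rewrite ler_piMl ?(ltW u0)// ltW.
lra.
Qed.

Lemma noise_const_ge0 : 0 <= noise_const.
Proof.
have u0 := slack_gt0; have u1 := slack_le.
have lq : ln scale_ratio <= 1.
  by rewrite (le_trans _ u1)// le_ln1Dx// (lt_trans (ltrN10 _))// mulr_gt0.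
have lnq : ln (ln scale_ratio) <= 0 by rewrite ln_le0.
have l2 : 0 <= ln 2 :> R by rewrite ln_ge0// ler1n.
have c0 := level_const_ge0 u0.
have L0 : 0 <= L.
  by rewrite (le_trans _ slack_pow4)// exprn_ge0// addr_ge0// ltW.
rewrite /noise_const; apply: addr_ge0; first by apply: mulr_ge0 => //; lra.
apply: mulr_ge0; last exact: addr_ge0.
have s0 : 0 <= 1 + slack by rewrite addr_ge0// ltW.
apply: addr_ge0; first by rewrite mulr_ge0 ?exprn_ge0.
by rewrite divr_ge0 ?(ltW u0)// mulr_ge0 ?exprn_ge0.
Qed.

Lemma energy_const_bounds :
  [/\ 8 * noise_const / gap <= energy_const,
   64 * 64 / far_ratio <= energy_const,
   8 * 64 / (far_ratio * gap ^+ 2) <= energy_const & 0 < energy_const].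
Proof.
have /andP[g0 _] := gap_bounds; have /andP[k0 _] := far_ratio_bounds.
have h1 : 0 <= 8 * noise_const / gap.
  by rewrite divr_ge0 ?(ltW g0)// mulr_ge0// noise_const_ge0.
have h2 : 0 < 64 * 64 / far_ratio by rewrite divr_gt0// mulr_gt0.
have h3 : 0 < 8 * 64 / (far_ratio * gap ^+ 2).
  by rewrite divr_gt0// mulr_gt0// exprn_gt0.
have sum (A B C : R) : 0 <= A -> 0 < B -> 0 < C ->
    [/\ A <= A + B + C, B <= A + B + C, C <= A + B + C & 0 < A + B + C].
  by move=> A0 B0 C0; split; lra.
exact: sum.
Qed.

(** Two symmetries lead to [contrast_lt]: exchanging the walks when the first piece is the longer
    one, and changing the signs of noise and jump when [D < 0]. Abstract walks allow use in both
    directions of time. *)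
Lemma penalised_cusum_lt (x : R) (n M a b : nat) (S Sr : nat -> R)
    (D pa pb : R) :
  0 < x -> n%:R < q ^+ M -> (0 < a < b)%N -> (b < n)%N -> D != 0 ->
  S 0%N = 0 -> (forall k, (k <= n)%N -> Sr k = S n - S (n - k)%N) ->
  within_scales u x q n M S -> within_scales u x q n M Sr ->
  (forall k, (k <= n)%N ->
     S k ^+ 2 <= x * ((k%:R + b%:R) ^+ 2 / (2 * b%:R))) ->
  (forall k, (k <= n)%N ->
     Sr k ^+ 2 <= x * ((k%:R + (n - b)%:R) ^+ 2 / (2 * (n - b)%:R))) ->
  `|S b - S a| <= `|D| * (b%:R - a%:R) / 32 + 16 * x / `|D| ->
  0 <= pa -> 0 <= pb ->
  (2 * ln (1 + ln a%:R) <= pa + 2 * ln 2 \/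
   2 * ln (1 + ln (n%:R / a%:R)) <= pa + 2 * ln 2) ->
  (2 * ln (1 + ln (n - a)%:R) <= pa + 2 * ln 2 \/
   2 * ln (1 + ln (n%:R / (n - a)%:R)) <= pa + 2 * ln 2) ->
  L ^+ 2 * pb + energy_const * (1 + x) <=
    D ^+ 2 * (b%:R * (n%:R - b%:R) / n%:R) ->
  let r := a%:R * (n%:R - b%:R) / (b%:R * (n%:R - a%:R)) in
  `|pb - pa| <= 2 * ln r^-1 ->
  r <= 1 / 2 \/ 8 * 64 * x / D ^+ 2 < b%:R - a%:R ->
  (S a - a%:R / n%:R * S n + a%:R * (n%:R - b%:R) / n%:R * D) ^+ 2
    * (n%:R / (a%:R * (n%:R - a%:R))) - L * pa <
  (S b - b%:R / n%:R * S n + b%:R * (n%:R - b%:R) / n%:R * D) ^+ 2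
    * (n%:R / (b%:R * (n%:R - b%:R))) - L * pb.
Proof.
move=> x0 nM /andP[a0 ab] bn D0 S0 SrE wS wSr lS lSr loc pa0 pb0 dl dr hE r
  lip bad.
have an : (a < n)%N := ltn_trans ab bn.
have n0 : (0 < n)%N := ltn_trans a0 an.
have an' : (0 < a < n)%N by rewrite a0.
have ra0 : 0 < a%:R :> R by rewrite ltr0n.
have rab : a%:R < b%:R :> R by rewrite ltr_nat.
have rbn : b%:R < n%:R :> R by rewrite ltr_nat.
have rn0 : n%:R != 0 :> R by rewrite pnatr_eq0 -lt0n.
have Srn : Sr n = S n by rewrite SrE// subnn S0 subr0.
have Sra : Sr (n - a)%N = S n - S a by rewrite SrE ?leq_subr// subKn// ltnW.
have Srb : Sr (n - b)%N = S n - S b by rewrite SrE ?leq_subr// subKn// ltnW.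
have u0 : 0 < u := slack_gt0.
have hC : (1 + u) * ((S a - a%:R / n%:R * S n) ^+ 2 *
    (n%:R / (a%:R * (n%:R - a%:R)))) <= L * pa + noise_const * (1 + x).
  have [a2|a2] := leqP (2 * a) n.
    apply: (noise_cusum_le u0 x0 erefl slack_le slack_pow4 nM an' a2 pa0 wS wSr)
      => //.
    by rewrite Sra; ring.
  have na : (0 < n - a < n)%N by rewrite subn_gt0 an ltn_subrL a0.
  have na2 : (2 * (n - a) <= n)%N.
    by rewrite mulnBr leq_subLR mul2n -addnn leq_add2r ltnW.
  have := noise_cusum_le u0 x0 erefl slack_le slack_pow4 nM na na2 pa0
    wSr wS dr.
  rewrite subKn ?(ltnW an)// Srn Sra natrB ?(ltnW an)//.
  move=> /(_ _) H; apply: le_trans (H _); last by ring.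
  rewrite le_eqVlt; apply/orP; left; apply/eqP; congr (_ * _).
  field; rewrite rn0 subKr !gt_eqF//= subr_gt0.
  exact: lt_trans rbn.
have [cL1 cL2 cL3 _] := energy_const_bounds.
have kE : (1 + u^-1) * far_ratio = gap / 4.
  by rewrite /far_ratio -/u; field; rewrite !gt_eqF// addr_gt0.
have key := contrast_lt L12 u0 (erefl gap) kE far_ratio_bounds
  cL1 cL2 cL3 x0 ra0 rab rbn.
have la := lS a (ltnW an); have lb := lS b (ltnW bn).
have lra' := lSr (n - a)%N (leq_subr _ _).
have lrb := lSr (n - b)%N (leq_subr _ _).
rewrite Sra !natrB ?(ltnW an) ?(ltnW bn)// in lra'.
rewrite Srb !natrB ?(ltnW an) ?(ltnW bn)// in lrb.
move: D0; rewrite neq_lt => /orP[D0|D0]; last first.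
  rewrite (gtr0_norm D0) in loc.
  exact: (key D pa pb (S a) (S b) (S n) D0 pb0 hE lip la lra' lb lrb hC loc
    bad).
have D0' : 0 < - D by rewrite oppr_gt0.
rewrite (ltr0_norm D0) in loc.
have neg k s : - s - k%:R / n%:R * - S n + k%:R * (n%:R - b%:R) / n%:R * - D =
    - (s - k%:R / n%:R * S n + k%:R * (n%:R - b%:R) / n%:R * D) by ring.
have := key (- D) pa pb (- S a) (- S b) (- S n) D0' pb0.
rewrite !neg !sqrrN; apply => //.
- by rewrite -opprD sqrrN.
- by rewrite -opprD sqrrN.
- by move: hC; rewrite -sqrrN; congr (_ * (_ ^+ 2 * _) <= _); ring.
- by rewrite -opprD normrN.
Qed.

End one_side.

(** * The CUSUM statistic of the observation *)

Section observation.
Variables (R : realType) (n b : nat) (theta : 'rV[R]_n) (mu1 mu2 : R).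
Hypotheses (bn : (b < n)%N)
  (thetaE : forall i : 'I_n, theta 0 i = if (i < b)%N then mu1 else mu2).
Variables (T : Type) (eps : 'I_n -> T -> R) (w : T).

Let y := observation theta eps w.
Let S := psum (eps ^~ w).
Let n0 : n%:R != 0 :> R.
Proof. by rewrite pnatr_eq0 -lt0n (leq_ltn_trans _ bn). Qed.

Lemma psum_observation k : (k <= n)%N ->
  psum (y 0) k = mu1 * (minn k b)%:R + mu2 * (k - b)%:R + S k.
Proof.
move=> kn; rewrite -(@psum_two_levels _ n)// -psumD; apply: eq_bigr => i _.
by rewrite mxE thetaE.
Qed.

Lemma cusum2_observation_left a : (a <= b)%N ->
  cusum2 (y 0) a =
  (S a - a%:R / n%:R * S n + a%:R * (n%:R - b%:R) / n%:R * - (mu2 - mu1)) ^+ 2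
  * (n%:R / (a%:R * (n%:R - a%:R))).
Proof.
move=> ab; rewrite /cusum2 !psum_observation//; last first.
  by rewrite (leq_trans ab)// ltnW.
congr (_ ^+ 2 * _).
rewrite (minn_idPl ab) (eqP ab) (minn_idPr (ltnW bn)) natrB 1?ltnW//.
by field.
Qed.

(* With mu2 - mu1 in place of its opposite, this is the left formula read
   backwards in time. *)
Lemma cusum2_observation_right a : (b <= a <= n)%N ->
  cusum2 (y 0) a =
  ((S n - S a) - (n%:R - a%:R) / n%:R * S n
     + (n%:R - a%:R) * b%:R / n%:R * (mu2 - mu1)) ^+ 2
  * (n%:R / (a%:R * (n%:R - a%:R))).
Proof.
move=> /andP[ba an]; rewrite /cusum2 !psum_observation//.
rewrite (minn_idPr ba) (minn_idPr (ltnW bn)) (natrB _ ba) (natrB _ (ltnW bn)).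
rewrite -[in RHS]sqrrN; congr (_ ^+ 2 * _).
by field.
Qed.

End observation.

(** * Localization of the estimated change-point *)

Theorem proposition3 (R : realType) :
  exists c : R, 0 < c /\
  forall L : R, 1 < L <= 2 ->
  exists cL cL' : R, [/\ 0 < cL, 0 < cL' &
  forall n : nat, cL' <= n%:R ->
  forall (d : measure_display) (T : measurableType d) (P : probability T R)
    (eps : 'I_n -> {RV P >-> R}),
    independent_rvs P eps ->
    (forall i, ('E_P[eps i] = 0)%E) ->
    (forall i (t : R), ('M_P (eps i) t <= (expR (t ^+ 2 / 2))%:E)%E) ->
  forall (theta : 'rV[R]_n) (taus : nat) (mu1 mu2 : R),
    in_Theta1 theta taus mu1 mu2 ->
  forall tauh : {RV P >-> nat},
    (forall w : T, minimizes_Cr1 L (observation theta (fun i => eps i) w) (tauh w)) ->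
  let Delta := mu2 - mu1 in
  let E1 := energy1 n taus Delta in
    L ^+ 2 * pen1 R n taus + cL < E1 ^+ 2 ->
  forall x : R, 0 < x < (E1 ^+ 2 - L ^+ 2 * pen1 R n taus - cL) / cL ->
    ((1 - 32 * expR (- x))%:E <
     P [set w : T |
         (`|(tauh w)%:R - taus%:R| <= c * Num.max 1 x / Delta ^+ 2 /\
          1 / 2 < (((tauh w)%:R - 1) * (n.+1%:R - taus%:R)
                  / ((taus%:R - 1) * (n.+1%:R - (tauh w)%:R)) : R) < 2)%R])%E].
Proof.
exists (8 * 64); split; first by rewrite mulr_gt0.
move=> L L12; exists (energy_const L), 1; split=> //.
  by case: (energy_const_bounds L12).
move=> n _ d T P eps ind _ sub theta taus mu1 mu2 [cps mu12 thetaE] tauh tauhP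
  Delta E1 _ x /andP[x0 xlt].
have cL0 : 0 < energy_const L by case: (energy_const_bounds L12).
have [tE bn01 rb0 rbn] := @change_point_pred R _ _ cps.
set b := taus.-1 in tE bn01 rb0 rbn.
have /andP[b0 bn] := bn01.
have n0 : (0 < n)%N := ltn_trans b0 bn.
have Delta0 : Delta != 0 by rewrite subr_eq0 eq_sym.
have nDelta0 : 0 < `|Delta| by rewrite normr_gt0.
have E1E : E1 ^+ 2 = Delta ^+ 2 * (b%:R * (n%:R - b%:R) / n%:R).
  have t1 : taus%:R - 1 = b%:R :> R by rewrite tE -natr1 addrK.
  have t2 : n.+1%:R - taus%:R = n%:R - b%:R :> R by rewrite tE -!natr1; ring.
  rewrite /E1 /energy1 t1 t2 exprMn real_normK ?num_real// sqr_sqrtr//.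
  by rewrite divr_ge0// mulr_ge0// subr_ge0 ltW.
have hE : L ^+ 2 * pen1 R n taus + energy_const L * (1 + x) <= E1 ^+ 2.
  by move: xlt; rewrite ltr_pdivlMr// => ?; lra.
have u0 := slack_gt0 L12.
have q1 := scale_ratio_gt1 L12.
have [M nM] := @exists_scale_bound R _ n q1.
have [A [mA PA good]] :=
  noise_outside_bad ind sub n0 M bn01 u0 x0 q1 nDelta0.
set G := [set w | _ ].
(* The event is a preimage under [tauh] of a set of naturals, and all such sets are measurable. *)
have mG : measurable G.
  have -> : G = tauh @^-1` [set k : nat |
      `|k%:R - taus%:R| <= 8 * 64 * Num.max 1 x / Delta ^+ 2 /\
      1 / 2 < ((k%:R - 1) * (n.+1%:R - taus%:R)
                  / ((taus%:R - 1) * (n.+1%:R - k%:R)) : R) < 2] by [].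
  exact: measurable_funPTI.
(* The bad event costs at most 16 times [expR (- x)]; the gap between 16 and 32 gives the strict
   inequality. *)
apply: (@lt_le_trans _ _ (P (~` A))).
  rewrite probability_setC// -(@fineK _ (P A)) ?fin_num_measure// in PA *.
  rewrite -EFinD lte_fin ltrD2l ltrN2 lee_fin in PA *.
  by rewrite (le_lt_trans PA)// ltr_pM2r ?expR_gt0// ltr_nat.
apply: le_measure; rewrite ?inE//; first exact: measurableC.
move=> w /good; set S := psum (eps ^~ w) => -[wS wSr lS lSr loc].
(* If the conclusion failed, the criterion would be strictly smaller at [taus] than at [tauh w]. *)
apply: contrapT => nG.
have [cph /(_ taus cps)] := tauhP w.
have [hEq an01 ra0 ran] := @change_point_pred R _ _ cph.
set a := (tauh w).-1 in hEq an01 ra0 ran.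
have /andP[a0 an] := an01.
apply/negP; rewrite -ltNge !Cr1_cusum2// -/a -/b.
set y := observation _ _ w; set K := _ - _ / _.
suff : cusum2 (y 0) a - L * pen1 R n (tauh w) <
    cusum2 (y 0) b - L * pen1 R n taus.
  by clearbody K; lra.
have natD1 (k : nat) : k.+1%:R - 1 = k%:R :> R by rewrite -natr1 addrK.
have natB1 (k : nat) : n.+1%:R - k.+1%:R = n%:R - k%:R :> R.
  by rewrite -!natr1; ring.
pose rho := a%:R * (n%:R - b%:R) / (b%:R * (n%:R - a%:R)) : R.
have thetaE' (i : 'I_n) : theta 0 i = if (i < b)%N then mu1 else mu2.
  by rewrite thetaE tE ltnS.
have nb0 : 0 < n%:R - b%:R :> R by rewrite subr_gt0.
have na0 : 0 < n%:R - a%:R :> R by rewrite subr_gt0.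
have rho0 : 0 < rho by rewrite divr_gt0// mulr_gt0.
(* [rho] is the ratio of the conclusion, so failure means one of these; [x <= Num.max 1 x] gives the
   last one. *)
have far : [\/ rho <= 1 / 2, 2 <= rho |
    8 * 64 * x / Delta ^+ 2 < `|a%:R - b%:R|].
  have [|r1] := leP rho (1 / 2); first by constructor 1.
  have [|r2] := leP 2 rho; first by constructor 2.
  constructor 3; rewrite ltNge; apply/negP => close; apply: nG; rewrite /G/=.
  rewrite hEq tE !natD1 !natB1 r1 r2; split=> //.
  have -> : a.+1%:R - b.+1%:R = a%:R - b%:R :> R by rewrite -!natr1; ring.
  rewrite (le_trans close)// ler_pM2r ?invr_gt0 ?exprn_even_gt0//.
  by rewrite ler_pM2l ?mulr_gt0// le_max lexx orbT.
have far_max (z : R) : 8 * 64 * x / Delta ^+ 2 < z -> 0 < z.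
  apply: le_lt_trans.
  by rewrite divr_ge0 ?sqr_ge0// ?mulr_ge0// ltW.
have pen0 k : (0 < k < n)%N -> 0 <= pen1 R n k.+1.
  by move=> /andP[_ kn]; exact: pen1_ge0.
have pa0 : 0 <= pen1 R n a.+1 := pen0 _ an01.
have pb0 : 0 <= pen1 R n b.+1 := pen0 _ bn01.
have S0 : S 0%N = 0 by exact: psum0.
rewrite E1E tE in hE.
rewrite hEq tE.
have [ab|ba|ab] := ltngtP a b; last first.
- exfalso; case: far;
    rewrite /rho ab ?subrr ?normr0 ?divff ?mulf_neq0 ?gt_eqF//.
  + by lra.
  + by lra.
  + by move/far_max; rewrite ltxx.
(* Time is reversed: [n - a < n - b] replace the two splits, the walks are exchanged, and [rho]
   becomes its inverse. *)
- have rba : b%:R < a%:R :> R by rewrite ltr_nat.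
  have nab : (0 < n - a < n - b)%N by rewrite subn_gt0 an ltn_sub2l.
  have nbn : (n - b < n)%N by rewrite ltn_subrL b0.
  have SE k : (k <= n)%N ->
      S k = (S n - S (n - n)%N) - (S n - S (n - (n - k))%N).
    by move=> kn; rewrite subnn S0 subKn//; ring.
  have Sr0 : S n - S (n - 0)%N = 0 by rewrite subn0 subrr.
  have bnE : (n - (n - b))%N = b by rewrite subKn// ltnW.
  have anE : (n - (n - a))%N = a by rewrite subKn// ltnW.
  have := @penalised_cusum_lt _ _ L12 x n M (n - a)%N (n - b)%N
    (fun k => S n - S (n - k)%N) S Delta (pen1 R n a.+1) (pen1 R n b.+1)
    x0 nM nab nbn Delta0 Sr0 SE wSr wS lSr.
  rewrite bnE anE => /(_ lS).
  rewrite !(natrB _ (ltnW an)) !(natrB _ (ltnW bn)).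
  have subsub (k : nat) : n%:R - (n%:R - k%:R) = k%:R :> R by ring.
  rewrite !subsub subnn S0 subr0.
  rewrite (cusum2_observation_right bn thetaE') ?(ltnW ba) ?(ltnW an)//.
  rewrite (cusum2_observation_right bn thetaE') ?leqnn ?(ltnW bn)//.
  rewrite ![(n%:R - _) * _%:R]mulrC.
  apply => //.
  + have -> : S n - S b - (S n - S a) = - (S b - S a) by ring.
    have -> : n%:R - b%:R - (n%:R - a%:R) = a%:R - b%:R :> R by ring.
    have := loc a (ltnW an); rewrite normrN (distrC b%:R).
    by rewrite (ger0_norm (_ : 0 <= a%:R - b%:R))// subr_ge0 ltW.
  + by rewrite -(natrB _ (ltnW an)); exact: pen1_lower_right.
  + exact: pen1_lower_left.
  + by rewrite distrC; apply: pen1_lip => //; rewrite ba.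
  + have -> : b%:R * (n%:R - a%:R) / (a%:R * (n%:R - b%:R)) = rho^-1.
      by rewrite /rho invf_div.
    have -> : n%:R - b%:R - (n%:R - a%:R) = a%:R - b%:R :> R by ring.
    case: far => [r1|r2|].
    * have : 1 < rho.
        rewrite ltr_pdivlMr ?mulr_gt0// mul1r -subr_gt0.
        have -> : a%:R * (n%:R - b%:R) - b%:R * (n%:R - a%:R) =
            n%:R * (a%:R - b%:R) :> R by ring.
        by rewrite mulr_gt0 ?subr_gt0// ltr0n.
      by move=> ?; exfalso; lra.
    * by left; rewrite mul1r lef_pV2 ?posrE.
    * by rewrite (gtr0_norm (_ : 0 < a%:R - b%:R)) ?subr_gt0//; right.
(* Forward in time, with jump [- Delta] since the first piece carries [mu1]. *)
- have rab : a%:R < b%:R :> R by rewrite ltr_nat.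
  have abn : (0 < a < b)%N by rewrite a0.
  rewrite !(cusum2_observation_left bn thetaE')// ?(ltnW ab)//.
  have D0 : - Delta != 0 by rewrite oppr_eq0.
  apply: (penalised_cusum_lt L12 x0 nM abn bn D0 S0 (fun _ _ => erefl)
    wS wSr lS lSr) => //.
  + have := loc a (ltnW an); rewrite normrN.
    by rewrite (ger0_norm (_ : 0 <= b%:R - a%:R))// subr_ge0 ltW.
  + exact: pen1_lower_left.
  + exact: pen1_lower_right.
  + by rewrite sqrrN.
  + by apply: pen1_lip; rewrite ?ab.
  + rewrite sqrrN -/rho; case: far => [|r2|]; first by left.
      have : rho < 1.
        rewrite ltr_pdivrMr ?mulr_gt0// mul1r -subr_gt0.
        have -> : b%:R * (n%:R - a%:R) - a%:R * (n%:R - b%:R) =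
            n%:R * (b%:R - a%:R) :> R by ring.
        by rewrite mulr_gt0 ?subr_gt0// ltr0n.
      by move=> ?; exfalso; lra.
    by rewrite distrC (gtr0_norm (_ : 0 < b%:R - a%:R)) ?subr_gt0//; right.
Qed.
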